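(* Let $\alpha>0$, let $U\in\mathcal{RV}'_{1/\alpha}$, and let $X_1,\dots,X_n$ be i.i.d. with $X_i\sim\mathrm{RV}(U)$. Let $k=k_n$ be an intermediate sequence. Let $\theta_k>0$ be a sequence with $\theta_k=O(1)$ such that $\theta_k\gg\varepsilon(n/(\eta k))+k^{-1/2}$ for some fixed $\eta>1$, where $\varepsilon(\cdot)$ is the Potter rate of $U$. Then $$-\log\mathbb{P}(\alpha H_{k,n}>1+\theta_k)\sim k f(-\theta_k)\qquad\text{as } n\to\infty,$$ where $f(\theta)=-\theta-\log(1-\theta)\ge 0$ for $\theta<1$. Moreover, if additionally $\limsup_{k\to\infty}\theta_k<1$, then $$-\log\mathbb{P}(\alpha H_{k,n}<1-\theta_k)\sim k f(\theta_k).$$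
   Context: A function $g$ is regularly varying with exponent $\gamma$ ($g\in\mathcal{RV}_\gamma$) if $g(tx)/g(t)\to x^\gamma$ as $t\to\infty$ for every $x>0$. $\mathcal{RV}'_\gamma$ is the set of positive, non-decreasing, left-continuous functions in $\mathcal{RV}_\gamma$ (defined on $(1,\infty)$). $X\sim\mathrm{RV}(U)$ means $X\stackrel{d}{=}U(e^E)$ with $E\sim\mathrm{Exp}(1)$; equivalently $X$ is a positive random variable with tail quantile function $U(t)=\inf\{u: F(u)\ge 1-1/t\}$, $t>1$, $F$ being its distribution function. Order statistics in decreasing order: $X_{1,n}\ge\dots\ge X_{n,n}$. The Hill statistic is $H_{k,n}=\frac1k\sum_{i=1}^k\log(X_{i,n}/X_{k,n})$. Intermediate sequence: $k=k_n$ are integers with $k_n\to\infty$ and $k_n/n\to0$; all limits are along this sequence as $n\to\infty$, and $\theta_k$ is evaluated at $k=k_n$. $a\gg b$ means $b/a\to0$; $a\sim b$ means $a/b\to1$. Potter rate of $U$: $$\varepsilon(t)=\inf\Big\{\varepsilon>0:\ \forall x\ge y\ge t:\ (1-\varepsilon)(x/y)^{(1-\varepsilon)/\alpha}\le \tfrac{U(x)}{U(y)}\le(1+\varepsilon)(x/y)^{(1+\varepsilon)/\alpha}\Big\}.$$ *)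

(* Defs.v *)
From mathcomp Require Import all_boot all_order all_algebra finmap.
From mathcomp Require Import all_classical all_reals all_analysis.

Set Implicit Arguments.
Unset Strict Implicit.
Unset Printing Implicit Defensive.

Import Order.TTheory GRing.Theory Num.Theory.
Import numFieldNormedType.Exports.

Local Open Scope classical_set_scope.
Local Open Scope ring_scope.

(* A function on (1, +oo) is a total function R -> R; its values outside
   (1, +oo) do not affect any of the notions below (potter_rate: for t > 1). *)

Definition regularly_varying (R : realType) (g : R) (U : R -> R) : Prop :=
  forall x : R, 0 < x -> U (t * x) / U t @[t --> +oo] --> x `^ g.

Definition RV' (R : realType) (g : R) (U : R -> R) : Prop :=
  [/\ forall t : R, 1 < t -> 0 < U t,
      forall s t : R, 1 < s -> s <= t -> U s <= U t,
      forall t : R, 1 < t -> U x @[x --> t^'-] --> U t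
    & regularly_varying g U].

(* X ~ RV(U): X has the law of U (expR E) with E ~ Exp(1). The event E > 0 has
   probability one and ensures that U is only evaluated on (1, +oo). *)
Definition has_tail_quantile (R : realType) d (T : measurableType d)
    (P : probability T R) (U : R -> R) (X : {RV P >-> R}) : Prop :=
  forall A : set R, measurable A ->
    distribution P X A =
    exponential_prob 1 ([set s : R | 0 < s] `&` (U \o expR) @^-1` A).

Definition mutually_independent (R : realType) d (T : measurableType d)
    (P : probability T R) (X : nat -> {RV P >-> R}) : Prop :=
  forall (J : {fset nat}) (B : nat -> set R), (forall i, measurable (B i)) ->
    P (\bigcap_(i in [set` J]) (X i @^-1` B i)) =
    (\prod_(i <- J) P (X i @^-1` B i))%E.

(* The i-th largest (1 <= i <= n) of the n values x 0, ..., x n.-1. *)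
Definition order_stat (R : realType) (x : nat -> R) (i n : nat) : R :=
  nth 0 (sort (fun a b : R => b <= a) [seq x j | j <- iota 0 n]) i.-1.

Definition hill (R : realType) (x : nat -> R) (k n : nat) : R :=
  k%:R^-1 * \sum_(1 <= i < k.+1) ln (order_stat x i n / order_stat x k n).

(* For U in RV'_(1/alpha) and t > 1 the set below is nonempty and bounded from
   below, so that the real-valued inf is the genuine infimum. *)
Definition potter_rate (R : realType) (alpha : R) (U : R -> R) (t : R) : R :=
  inf [set e : R | 0 < e /\ forall x y : R, t <= y -> y <= x ->
    (1 - e) * (x / y) `^ ((1 - e) / alpha) <= U x / U y /\
    U x / U y <= (1 + e) * (x / y) `^ ((1 + e) / alpha)].

Definition rate_fun (R : realType) (x : R) : R := - x - ln (1 - x).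

Definition intermediate (R : realType) (k : nat -> nat) : Prop :=
  k @ \oo --> \oo /\ ((k n)%:R / n%:R : R) @[n --> \oo] --> (0 : R).

Definition much_larger (R : realType) (a b : nat -> R) : Prop :=
  b n / a n @[n --> \oo] --> (0 : R).

Definition asymp_equiv (R : realType) (a b : nat -> R) : Prop :=
  a n / b n @[n --> \oo] --> (1 : R).

(* - log P(A). The library sets ln 0 = 0, whereas - log 0 = +oo; an equivalence
   asymp_equiv between neg_log_prob and another sequence forces
   neg_log_prob <> 0, hence P(A) > 0, for all large n, so it says the same
   thing under both conventions. *)
Definition neg_log_prob (R : realType) d (T : measurableType d)
    (P : probability T R) (A : set T) : R :=
  - ln (fine (P A)).

(* Main.v *)
(** By Renyi's representation, n independent Exp(1) variables put the k-th largest one at a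
    level independent of the total excess of the larger ones over it, and that excess is
    Gamma(k - 1) distributed. The representation is obtained here from Mecke's formula, by
    summing over the sample point that is the k-th largest. Chernoff's bound for the upper
    estimate, and an exponential change of measure with concentration for the lower one, show
    that the normalised excess D satisfies [- ln P (D > 1 + t) ~ k f(-t)] and
    [- ln P (D < 1 - t) ~ k f(t)] as soon as t sqrt k tends to infinity. With X = U (exp E),
    the Potter bounds put alpha H between (1 - e) D - 2 alpha e and (1 + e) D + alpha e when
    the k-th largest exponential exceeds the level ln (n / (q k)); this fails with probability
    at most exp (- k f(1 - q)). For small theta one takes q = eta and e slightly above the
    Potter rate, hence e << theta; for theta bounded away from 0, a large fixed q makes the
    failure negligible and any fixed small e is available. *)
Require Import Defs.
From HB Require Import structures.
From mathcomp Require Import all_boot all_order all_algebra finmap.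
From mathcomp Require Import all_classical all_reals all_analysis.
From mathcomp Require Import measurable_realfun ring lra.

Import Order.TTheory GRing.Theory Num.Theory.
Import numFieldNormedType.Exports.
Import HBNNSimple.

Local Open Scope classical_set_scope.
Local Open Scope ring_scope.

(** Both tails are one computation in a signed deviation x, equal to - theta for the upper tail and
    to theta for the lower one; the event is squeezed between conditions on the excess at the
    dilated points (1 - d) x and (1 + 2 d) x. As theta may tend to 0 or stay of order one, every
    error has to be compared with k f(x) itself. This works because f(x) is at least a constant
    times x^2 on [- M, 1 - rho]: a dilation changes f(x) by a factor 1 + O(d), and the price exp (-
    16 |x| sqrt k) of a concentration window of width of order sqrt k is negligible once |x| sqrt k
    tends to infinity. This is one use of theta >> k^(-1/2); the other is that the infimum in the
    Potter rate need not be attained, so e exceeds it by up to k^(-1/2). Two regimes of theta are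
    needed because the failure of the level has rate k f(1 - q), which must be at least k f(x). With
    q = eta this holds for small theta only; since theta is merely bounded, q must otherwise depend
    on M, and Potter bounds at the new level come from regular variation alone. *)

(** * Convexity and quadratic bounds for the rate function *)

Section rate_function.
Context {R : realType}.
Implicit Types x y M rho : R.
Local Notation f := (@rate_fun R).

Lemma ln_le_subr1 x : 0 < x -> ln x <= x - 1.
Proof. by move=> x0; have := @le_ln1Dx R (x - 1); rewrite addrCA subrr addr0; apply; lra. Qed.

(** Convexity: the tangent to f at y, of slope y / (1 - y), lies below the graph. *)
Lemma rate_fun_sub_le x y : x < 1 -> y < 1 -> f y - f x <= (y - x) * y / (1 - y).
Proof.
move=> x1 y1; rewrite /rate_fun.
have := ln_le_subr1 ((1 - x) / (1 - y)); rewrite divr_gt0 ?subr_gt0// => /(_ isT).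
rewrite ln_div ?posrE ?subr_gt0// => h.
apply: (@le_trans _ _ ((x - y) + ((1 - x) / (1 - y) - 1))); first by lra.
by rewrite le_eqVlt; apply/orP; left; apply/eqP; field; lra.
Qed.

Lemma rate_fun0 : f 0 = 0.
Proof. by rewrite /rate_fun oppr0 addr0 ln1 subr0. Qed.

Lemma rate_fun_le_sqr x : x < 1 -> f x <= x ^+ 2 / (1 - x).
Proof.
move=> x1; have := rate_fun_sub_le 0 x ltr01 x1.
by rewrite rate_fun0 !subr0 -expr2.
Qed.

(** With r the square root of 1 - x, the bound ln r <= r - 1 gives f(x) >= (r - 1)^2, and (1 + r)^2
    <= 2 (1 + r^2) does the rest. The bound holds on the whole half line x < 1 and still grows
    linearly as x tends to -oo. *)
Lemma rate_fun_ge_sqr x : x < 1 -> x ^+ 2 / (2 * (2 - x)) <= f x.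
Proof.
move=> x1; have s0 : 0 < 1 - x by lra.
set r := Num.sqrt (1 - x).
have r0 : 0 < r by rewrite sqrtr_gt0.
have rE : r ^+ 2 = 1 - x by rewrite sqr_sqrtr// ltW.
have lr : ln (1 - x) <= 2 * (r - 1).
  rewrite -rE expr2 lnM ?posrE//.
  by have := ln_le_subr1 r r0; lra.
apply: (@le_trans _ _ ((r - 1) ^+ 2)); last first.
  by rewrite /rate_fun sqrrB rE; lra.
have -> : x = 1 - r ^+ 2 by lra.
rewrite ler_pdivrMr; last by nra.
have : 0 <= (r - 1) ^+ 4 by rewrite (_ : 4%N = (2 * 2)%N)// exprM sqr_ge0.
have := sqr_ge0 (r - 1).
nra.
Qed.

Lemma rate_fun_ge0 x : x < 1 -> 0 <= f x.
Proof.
move=> x1; apply: le_trans (rate_fun_ge_sqr x x1).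
by rewrite divr_ge0 ?sqr_ge0//; lra.
Qed.

End rate_function.

(** * Potter bounds for monotone regularly varying functions *)

Section potter.
Context {R : realType}.
Implicit Types (U : R -> R) (a e g x y t : R).

Definition potter_bounds a U t e := 0 < e /\ forall x y : R, t <= y -> y <= x ->
  (1 - e) * (x / y) `^ ((1 - e) / a) <= U x / U y /\
  U x / U y <= (1 + e) * (x / y) `^ ((1 + e) / a).

Lemma geometric_bracket (l z : R) : 1 < l -> 1 <= z ->
  exists m : nat, l ^+ m <= z < l ^+ m.+1.
Proof.
move=> l1 z1.
have [N hN] : exists N : nat, z < l ^+ N.
  have bern n : 1 + n%:R * (l - 1) <= l ^+ n.
    elim: n => [|n ih]; first by rewrite mul0r addr0 expr0.
    rewrite exprS -natr1; move: (ler_pM2l (lt_trans ltr01 l1) (1 + n%:R * (l - 1)) (l ^+ n)); rewrite ih => h.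
    have n0 : 0 <= n%:R * (l - 1) ^+ 2 by rewrite mulr_ge0// sqr_ge0.
    by apply: le_trans h; nra.
  have [N hN] : exists N : nat, z / (l - 1) < N%:R.
    by exists (Num.bound (z / (l - 1))); rewrite archi_boundP// divr_ge0//; lra.
  exists N; apply: lt_le_trans (bern N).
  by move: hN; rewrite ltr_pdivrMr; lra.
have [m hm mmin] := ex_minnP (ex_intro (fun n : nat => z < l ^+ n) N hN).
case: m hm mmin => [|m] hm mmin; first by move: hm; rewrite expr0 ltNge z1.
exists m; rewrite hm andbT leNgt; apply/negP => /mmin; by rewrite ltnn.
Qed.

(** Potter's theorem. Monotonicity of U makes one ratio l > 1 sufficient: regular variation at l is
    iterated along y, y l, y l^2, ..., and U(x) is compared with its values at the two neighbouring
    grid points. *)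
Lemma potter_bounds_eventually a U e : 0 < a -> RV' a^-1 U -> 0 < e < 1 ->
  exists t0 : R, forall t, t0 <= t -> potter_bounds a U t e.
Proof.
move=> a0 [Ugt0 Und _ Urv] /andP[e0 e1].
pose g := a^-1; have g0 : 0 < g by rewrite invr_gt0.
(* Chosen so that l to the power (1 + e) / a is exactly 1 + e: rounding x / y up to a power of l
   then costs just the constant that the upper bound allows. *)
pose l := (1 + e) `^ (a / (1 + e)).
have le0 : 0 < a / (1 + e) by rewrite divr_gt0//; lra.
have one_powR c : 1 `^ c = 1 :> R by rewrite powR1.
have l1 : 1 < l by rewrite /l -[ltLHS](one_powR (a / (1 + e))) gt0_ltr_powR// ?nnegrE; lra.
have l0 : 0 < l by lra.
have lup : l `^ ((1 + e) / a) = 1 + e.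
  rewrite /l -powRrM (_ : _ * _ = 1) ?powRr1//; first by lra.
  by field; apply/andP; split; lra.
have ldn : l `^ ((1 - e) / a) <= 1 + e.
  rewrite -lup; apply: ler_powR; first exact: ltW.
  by rewrite ler_pM2r ?invr_gt0//; lra.
have powR_lt b c : b < c -> l `^ b < l `^ c.
  by move=> bc; rewrite /powR !gt_eqF// ltr_expR ltr_pM2r// ln_gt0.
have lg : 1 < l `^ a^-1.
  by rewrite -[ltLHS](one_powR a^-1) gt0_ltr_powR// ?nnegrE; lra.
have lgup : l `^ a^-1 < l `^ ((1 + e) / a).
  by apply: powR_lt => //; rewrite -[ltLHS]mul1r ltr_pM2r//; lra.
have lgdn : l `^ ((1 - e) / a) < l `^ a^-1.
  by apply: powR_lt => //; rewrite -[ltRHS]mul1r ltr_pM2r//; lra.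
have [t1 [_ ht1]] : \forall t \near +oo, 1 < t /\
    l `^ ((1 - e) / a) <= U (t * l) / U t <= l `^ ((1 + e) / a).
  near=> t; split; first by near: t; exact: nbhs_pinfty_gt.
  apply/andP; split; near: t.
    exact: (cvgr_ge _ (Urv l l0)).
  exact: (cvgr_le _ (Urv l l0)).
have step y m : t1 < y -> l `^ ((1 - e) / a) ^+ m <= U (y * l ^+ m) / U y <= (l `^ ((1 + e) / a)) ^+ m.
  move=> ty; have y1 : 1 < y by have [] := ht1 y ty.
  have Uy : 0 < U y by exact: Ugt0.
  elim: m => [|m /andP[ih1 ih2]].
    by rewrite !expr0 mulr1 divff ?lexx// gt_eqF.
  have lm1 : 1 <= l ^+ m by rewrite exprn_ege1// ltW.
  have tylm : t1 < y * l ^+ m by rewrite (lt_le_trans ty)// ler_peMr//; lra.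
  have [ym1 /andP[h1 h2]] := ht1 _ tylm.
  have Uym : 0 < U (y * l ^+ m) by exact: Ugt0.
  have -> : U (y * l ^+ m.+1) / U y =
      (U (y * l ^+ m * l) / U (y * l ^+ m)) * (U (y * l ^+ m) / U y).
    by rewrite exprSr mulrA; field; rewrite !gt_eqF.
  by rewrite !exprS; apply/andP; split; apply: ler_pM; rewrite ?powR_ge0 ?exprn_ge0 ?powR_ge0// divr_ge0// ltW// Ugt0//; nra.
exists (t1 + 1) => t t1t; split => // x y ty yx.
have t1y : t1 < y by lra.
have [y1 _] := ht1 y t1y.
have y0 : 0 < y by lra.
have Uy : 0 < U y by exact: Ugt0.
have xy1 : 1 <= x / y by rewrite ler_pdivlMr// mul1r.
have [m /andP[lm lmS]] := geometric_bracket l (x / y) l1 xy1.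
have powX c n : (l `^ c) ^+ n = (l ^+ n) `^ c.
  elim: n => [|n ihn]; first by rewrite !expr0 one_powR.
  by rewrite !exprS ihn -powRM ?exprn_ge0// ltW.
have lm1 n : 1 <= l ^+ n by rewrite exprn_ege1// ltW.
have ylm1 n : 1 < y * l ^+ n by rewrite (lt_le_trans y1)// ler_peMr//; lra.
have ce : 0 <= (1 - e) / a by rewrite divr_ge0//; lra.
have cE : 0 <= (1 + e) / a by rewrite divr_ge0//; lra.
split.
  have /andP[h _] := step y m t1y.
  apply: (@le_trans _ _ (U (y * l ^+ m) / U y)); last first.
    rewrite ler_pM2r ?invr_gt0//; apply: Und => //.
    by rewrite mulrC -ler_pdivlMr.
  apply: le_trans h.
  apply: (@le_trans _ _ ((1 - e) * (l `^ ((1 - e) / a)) ^+ m.+1)).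
    rewrite ler_wpM2l//; first by lra.
    by rewrite powX ge0_ler_powR// ?nnegrE ?exprn_ge0//; lra.
  (* The grid step lost by rounding down is paid for by (1 - e) * (1 + e) <= 1. *)
  rewrite exprS mulrA -[leRHS]mul1r ler_wpM2r ?exprn_ge0 ?powR_ge0//.
  nra.
have /andP[_ h] := step y m.+1 t1y.
apply: (@le_trans _ _ (U (y * l ^+ m.+1) / U y)).
  rewrite ler_pM2r ?invr_gt0//; apply: Und; first by lra.
  by rewrite mulrC -ler_pdivrMr// ltW.
apply: (le_trans h); rewrite exprS lup ler_wpM2l//; first by lra.
by rewrite -{1}lup powX ge0_ler_powR// ?nnegrE ?exprn_ge0//; lra.
Unshelve. all: by end_near. Qed.

(** The infimum need not be attained, hence the slack [e1]; the existence hypothesis makes it a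
    genuine infimum. *)
Lemma potter_rate_lt a U t e1 : 0 < e1 ->
  (exists e, potter_bounds a U t e) ->
  0 <= potter_rate a U t /\
  exists e, [/\ potter_bounds a U t e & e < potter_rate a U t + e1].
Proof.
move=> e10 [e he].
have hi : has_inf [set e | potter_bounds a U t e].
  by split; [exists e|exists 0 => z [/ltW]].
split; first by apply: lb_le_inf; [exists e|move=> z [/ltW]].
have [z hz zlt] := inf_adherent e10 hi.
by exists z; split.
Qed.

End potter.

(** * Change of variables: densities and affine maps *)

(** True by definition on indicators, hence on simple functions, then by monotone convergence for
    integrands that may be infinite. *)
Lemma ge0_integral_density {d} {T : measurableType d} {R : realType}
    (mu nu : {measure set T -> \bar R}) (g : T -> R) (f : T -> \bar R) :
  measurable_fun setT g -> (forall x, 0 <= g x) ->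
  (forall A, measurable A -> nu A = \int[mu]_(x in A) (g x)%:E)%E ->
  measurable_fun setT f -> (forall x, 0 <= f x)%E ->
  (\int[nu]_x f x = \int[mu]_x (f x * (g x)%:E))%E.
Proof.
move=> mg g0 nuE mf f0; pose f_ := nnsfun_approx measurableT mf.
have f_f x : (f_ n x)%:E @[n --> \oo] --> f x.
  by apply: cvg_nnsfun_approx => // y _; exact: f0.
have f_nd x : {homo (fun n => (f_ n x)%:E) : n m / (n <= m)%N >-> (n <= m)%E}.
  by move=> m n mn; rewrite lee_fin; exact/lefP/nd_nnsfun_approx.
transitivity (limn (fun n => \int[nu]_x (f_ n x)%:E)%E).
  rewrite -monotone_convergence//.
  - by apply: eq_integral => x _; apply/esym/cvg_lim.
  - by move=> n; exact/measurable_EFinP.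
  - by move=> n x _; rewrite lee_fin.
transitivity (limn (fun n => \int[mu]_x ((f_ n x)%:E * (g x)%:E))%E); last first.
  rewrite -monotone_convergence//.
  - apply: eq_integral => x _; apply/cvg_lim => //.
    exact: cvgeZr.
  - move=> n; apply: emeasurable_funM; exact/measurable_EFinP.
  - by move=> n x _; rewrite mule_ge0// lee_fin.
  - by move=> x _ m n mn; apply: lee_wpmul2r; [rewrite lee_fin|exact: f_nd].
congr (limn _); apply/funext => n.
transitivity (\sum_(k \in range (f_ n)) k%:E * nu (f_ n @^-1` [set k]))%E.
  by rewrite integral_nnsfun// patch_setT sintegralE.
transitivity (\sum_(k \in range (f_ n))
    \int[mu]_x (k%:E * ((\1_(f_ n @^-1` [set k]) x)%:E * (g x)%:E)))%E; last first.
  rewrite -ge0_integral_fsum//.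
  - apply: eq_integral => x _; rewrite [in RHS]fimfunE -fsumEFin// ge0_mule_fsuml//.
      by apply: eq_fsbigr => r _; rewrite EFinM muleA.
    by move=> r; exact: nnfun_muleindic_ge0.
  - move=> r; apply: emeasurable_funM => //; apply: emeasurable_funM; exact/measurable_EFinP.
  - move=> r x _; rewrite muleA mule_ge0 ?lee_fin//.
    exact: nnfun_muleindic_ge0.
apply: eq_fsbigr => r /[!inE] -[x _ <-].
rewrite ge0_integralZl_EFin//; last 2 first.
  by move=> y _; rewrite mule_ge0// lee_fin.
  by apply: emeasurable_funM; exact/measurable_EFinP.
congr (_ * _)%E; rewrite nuE// integral_mkcond.
apply: eq_integral => y _; rewrite patchE indicE; case: ifPn => yr.
  by rewrite mul1e.
by rewrite mul0e.
Qed.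

(** The image of Lebesgue measure under x -> a x + b, multiplied by a, agrees with Lebesgue measure
    on half-open intervals, hence everywhere. *)
Lemma lebesgue_integral_affine {R : realType} (a b : R) (f : R -> \bar R) : 0 < a ->
  measurable_fun setT f -> (forall x, 0 <= f x)%E ->
  (\int[lebesgue_measure]_x f x =
   a%:E * \int[lebesgue_measure]_x f (a * x + b)%R)%E.
Proof.
move=> a0 mf f0.
pose phi : measurableTypeR R -> measurableTypeR R := fun x => a * x + b.
have mphi : measurable_fun setT phi.
  by apply: measurable_funD => //; exact: measurable_funM.
pose nu : {measure set (measurableTypeR R) -> \bar R} :=
  measure_function_pushforward__canonical__measure_function_Measure lebesgue_measure mphi.
transitivity (\int[mscale (NngNum (ltW a0)) nu]_x f x)%E.
  apply: eq_measure_integral => A mA _.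
  apply: lebesgue_measure_unique => //= _ [[p q]] _ <-.
  rewrite /mscale /= /pushforward.
  rewrite (_ : phi @^-1` _ = `](p - b) / a, (q - b) / a]%classic); last first.
    apply/seteqP; split => x /=; rewrite /phi !in_itv /= ltr_pdivrMr// ler_pdivlMr//;
      move=> /andP[? ?]; apply/andP; split; lra.
  rewrite !lebesgue_measure_itv/= !lte_fin ltr_pM2r ?invr_gt0// ltrD2r.
  case: ifPn => _; last by rewrite mule0.
  by rewrite -!EFinB -EFinM; congr EFin; field; lra.
rewrite ge0_integral_mscale//= ge0_integral_pushforward//.
Qed.

(** * The standard exponential law *)

Definition std_exponential (R : realType) : probability (measurableTypeR R) R :=
  exponential_distribution_exponential_prob__canonical__probability_measure_Probability
    (@ltr01 R).

Section std_exponential.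
Context {R : realType}.
Local Notation mu := (@lebesgue_measure R).
Local Notation expo := (std_exponential R).
Implicit Types (F : R -> \bar R) (x y s : R).

Lemma pdf1E x : exponential_pdf 1 x = if 0 <= x then expR (- x) else 0.
Proof.
case: ifPn => x0; first by rewrite exponential_pdfE// mul1r mulN1r.
by rewrite lt0_exponential_pdf// ltNge.
Qed.

Lemma integral_std_exponential F : measurable_fun setT F ->
  (forall x, 0 <= F x)%E ->
  (\int[expo]_x F x = \int[mu]_x (F x * (exponential_pdf 1 x)%:E))%E.
Proof.
move=> mF F0; apply: ge0_integral_density => //.
- exact: measurable_exponential_pdf.
- exact: exponential_pdf_ge0.
Qed.

Let mpdf : measurable_fun [set: R] (fun x => (@exponential_pdf R 1 x)%:E).
Proof. by apply/measurable_EFinP; exact: measurable_exponential_pdf. Qed.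

(** Lack of memory in integral form, by translating Lebesgue measure: an exceedance of y leaves a
    fresh Exp(1) excess. *)
Lemma std_exponential_memoryless F y : 0 <= y -> measurable_fun setT F ->
  (forall x, 0 <= F x)%E ->
  (\int[expo]_x ((\1_[set z | (y <= z)%R] x)%:E * F (x - y)%R) =
   (expR (- y))%:E * \int[expo]_x F x)%E.
Proof.
move=> y0 mF F0.
have mI : measurable [set z : R | y <= z].
  by rewrite -set_itvcy.
have mG : measurable_fun setT (fun x : R => ((\1_[set z : R | (y <= z)%R] x)%:E * F (x - y)%R)%E).
  apply: emeasurable_funM; first exact/measurable_EFinP/measurable_indic.
  by apply: (measurableT_comp mF); exact: measurable_funB.
have G0 x : (0 <= (\1_[set z : R | (y <= z)%R] x)%:E * F (x - y)%R)%E.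
  by rewrite mule_ge0// lee_fin.
rewrite !integral_std_exponential// (lebesgue_integral_affine 1 y)//; last 2 first.
- exact: emeasurable_funM.
- by move=> x; rewrite mule_ge0// lee_fin exponential_pdf_ge0.
rewrite mul1e -ge0_integralZl_EFin//; last 2 first.
- by move=> x _; rewrite mule_ge0// lee_fin exponential_pdf_ge0.
- exact: emeasurable_funM.
apply: eq_integral => x _; rewrite mul1r addrK !pdf1E indicE.
have -> : (x + y \in [set z | y <= z]) = (0 <= x).
  by apply/idP/idP; rewrite inE/= => ?; lra.
case: (leP 0 x) => x0; last by rewrite !mule0 !mul0e.
rewrite addr_ge0// mul1e muleCA -EFinM -expRD.
by congr (_ * (expR _)%:E)%E; ring.
Qed.

(** One-dimensional germ of the exponential change of measure: s times an Exp(1) variable has an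
    explicit density with respect to Exp(1). *)
Lemma std_exponential_scale F s : 0 < s -> measurable_fun setT F ->
  (forall x, 0 <= F x)%E ->
  (\int[expo]_x F x =
   s%:E * \int[expo]_x ((expR (- (s - 1) * x))%:E * F (s * x)%R))%E.
Proof.
move=> s0 mF F0.
have mG : measurable_fun setT (fun x : R => (expR (- (s - 1) * x))%:E * F (s * x)%R)%E.
  apply: emeasurable_funM; last by apply: (measurableT_comp mF); exact: measurable_funM.
  by apply/measurable_EFinP/measurableT_comp => //; exact: measurable_funM.
rewrite !integral_std_exponential//; last by move=> x; rewrite mule_ge0// lee_fin expR_ge0.
rewrite (lebesgue_integral_affine s 0)//; last 2 first.
- exact: emeasurable_funM.
- by move=> x; rewrite mule_ge0// lee_fin exponential_pdf_ge0.
congr (_ * _)%E; apply: eq_integral => x _.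
rewrite addr0 !pdf1E pmulr_rge0//; case: ifPn => x0; last by rewrite !mule0.
rewrite [RHS]muleAC -EFinM -expRD muleC.
by congr ((expR _)%:E * _)%E; ring.
Qed.

Lemma std_exponential_set1 x : expo [set x] = 0.
Proof. by rewrite /= /exponential_prob integral_set1. Qed.

Lemma std_exponential_ge y : 0 <= y ->
  expo [set x | y <= x] = (expR (- y))%:E.
Proof.
move=> y0; have mI : measurable [set z : R | y <= z].
  by rewrite -set_itvcy.
have := std_exponential_memoryless (cst 1%E) y y0 (measurable_cst _) (fun=> lee01).
under eq_integral do rewrite mule1.
rewrite integral_indic// setIT integral_cst//.
  by rewrite [X in (_ * (_ * X))%E](_ : _ = 1%E) ?mule1//; exact: probability_setT.
Qed.

Lemma std_exponential_gt0 : expo [set x | 0 < x] = 1%E.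
Proof.
have mI : measurable [set z : R | 0 < z].
  by rewrite -set_itvoy.
have := std_exponential_ge 0 (lexx _); rewrite oppr0 expR0 => <-.
rewrite (_ : [set x | 0 <= x] = [set x | 0 < x] `|` [set 0]).
  rewrite measureU//; last by apply/seteqP; split => // x/= [] /[swap] -> /=; rewrite ltxx.
  by rewrite [X in (_ + X)%E]std_exponential_set1 adde0.
apply/seteqP; split => x/=.
  by rewrite le_eqVlt eq_sym => /orP[/eqP ->|]; [right|left].
by move=> [/ltW|->].
Qed.

End std_exponential.

(** * Laws of i.i.d. tuples and Mecke's formula *)

Section iid_tuples.
Context {d} {T : measurableType d} {R : realType}.

(** Named so that it can be registered as a measurable function, which [distribution] requires. *)
Definition cons_pair n (p : T * n.-tuple T) : n.+1.-tuple T := [tuple of p.1 :: p.2].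

Lemma measurable_cons_pair n : measurable_fun setT (@cons_pair n).
Proof. exact: measurable_cons. Qed.

HB.instance Definition _ n :=
  isMeasurableFun.Build _ _ _ _ (@cons_pair n) (@measurable_cons_pair n).

(** Built by recursion so that an integral over a sample can be peeled one coordinate at a time. *)
Fixpoint iid (P : probability T R) n : probability (n.-tuple T) R :=
  if n is m.+1 then distribution (P \x iid P m)%E (@cons_pair m) else dirac [tuple].

Variable P : probability T R.

Lemma integral_iid0 (f : 0.-tuple T -> \bar R) : measurable_fun setT f ->
  (\int[iid P 0]_t f t = f [tuple])%E.
Proof. by move=> mf; rewrite /= integral_dirac// diracT mul1e. Qed.

Lemma integral_iidS n (f : n.+1.-tuple T -> \bar R) : measurable_fun setT f ->
  (forall t, 0 <= f t)%E ->
  (\int[iid P n.+1]_t f t = \int[P]_x \int[iid P n]_t f [tuple of x :: t])%E.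
Proof.
move=> mf f0; rewrite /= /distribution ge0_integral_pushforward//.
rewrite preimage_setT fubini_tonelli1//.
- by apply: measurableT_comp => //; exact: measurable_cons_pair.
- by move=> x; exact: f0.
Qed.

Lemma iidS n (A : set (n.+1.-tuple T)) : measurable A ->
  iid P n.+1 A = (\int[P]_x iid P n [set t : n.-tuple T | A [tuple of x :: t]])%E.
Proof.
move=> mA; rewrite /= /distribution /pushforward /= /product_measure1.
apply: eq_integral => x _ /=; congr (iid P n _).
by apply/seteqP; split => t /=; rewrite xsectionE.
Qed.

Lemma measurable_rect n (B : 'I_n -> set T) : (forall i, measurable (B i)) ->
  measurable [set t : n.-tuple T | forall i, B i (tnth t i)].
Proof.
move=> mB; rewrite (_ : [set _ | _] = \bigcap_(i in [set: 'I_n]) ((tnth (T:=T))^~ i @^-1` B i)).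
  apply: fin_bigcap_measurable => // i _; rewrite -[X in measurable X]setTI.
  exact: measurable_tnth.
by apply/seteqP; split => t /= h i; [move=> _|]; apply: h.
Qed.

Lemma iid_rect n (B : 'I_n -> set T) : (forall i, measurable (B i)) ->
  iid P n [set t | forall i, B i (tnth t i)] = (\prod_(i < n) P (B i))%E.
Proof.
elim: n B => [|n ih] B mB.
  by rewrite big_ord0 /= diracE mem_set// => -[].
rewrite iidS; last exact: measurable_rect.
rewrite big_ord_recl.
transitivity (\int[P]_x ((\1_(B ord0) x)%:E * \prod_(i < n) P (B (lift ord0 i)))%E)%E.
  apply: eq_integral => x _; rewrite indicE; case: (boolP (x \in B ord0)) => Bx.
    rewrite mul1e -ih; last by move=> i; exact: mB.
    congr (iid P n _); apply/seteqP; split => t /= h i.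
      by have := h (lift ord0 i); rewrite tnthS.
    case: (unliftP ord0 i) => [j ->|->]; first by rewrite tnthS; exact: h.
    by rewrite tnth0; exact/set_mem.
  rewrite mul0e (_ : [set _ | _] = set0) ?measure0//.
  apply/seteqP; split => // t /= /(_ ord0); rewrite tnth0 => /mem_set.
  by rewrite (negbTE Bx).
rewrite ge0_integralZr//.
- by rewrite integral_indic// setIT.
- exact/measurable_EFinP/measurable_indic.
- by apply: prode_ge0 => i _; exact: measure_ge0.
Qed.

(** Rectangles are stable under intersection and generate the sigma-algebra of tuples. *)
Lemma measure_tuple_unique n (m1 m2 : probability (n.-tuple T) R) :
  (forall B : 'I_n -> set T, (forall i, measurable (B i)) ->
     m1 [set t | forall i, B i (tnth t i)] = m2 [set t | forall i, B i (tnth t i)]) ->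
  forall A, measurable A -> m1 A = m2 A.
Proof.
move=> m12 A mA.
pose G := [set C | exists2 B : 'I_n -> set T, (forall i, measurable (B i)) &
   C = [set t : n.-tuple T | forall i, B i (tnth t i)]].
apply: (measure_unique G (fun=> setT)) => //.
- apply/seteqP; split.
    apply: smallest_sub; first exact: smallest_sigma_algebra.
    rewrite /= => C; rewrite -bigcup_seq => -[i /= _ [B mB <-]].
    apply: sub_sigma_algebra; exists (fun j => if j == i then B else setT).
      by move=> j; case: ifP.
    rewrite setTI; apply/seteqP; split => t /= => [Bt j|/(_ i)]; last by rewrite eqxx.
    by case: eqP => // ->.
  apply: smallest_sub; first exact: sigma_algebra_measurable.
  by move=> _ [B mB ->]; exact: measurable_rect.
- move=> _ _ [B mB ->] [C mC ->]; exists (fun i => B i `&` C i).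
    by move=> i; exact: measurableI.
  apply/seteqP; split => t /=.
    by move=> [? ?] i; split.
  by move=> h; split => i; have [] := h i.
- by move=> _; exists (fun=> setT) => //; apply/seteqP; split.
- by rewrite bigcup_const.
- by move=> _ [B mB ->]; exact: m12.
- by move=> _; rewrite -ge0_fin_numE// fin_num_measure.
Qed.

(** Functions of lists of every length: the induction for Mecke's formula moves one entry of the
    tuple into a fixed prefix, which changes the length. *)
Definition seq_measurable (h : T -> seq T -> \bar R) :=
  forall n, measurable_fun setT (fun p : T * n.-tuple T => h p.1 p.2).

Lemma seq_measurable_comp {d'} {T' : measurableType d'} h n (u : T' -> T)
    (v : T' -> n.-tuple T) : seq_measurable h -> measurable_fun setT u ->
  measurable_fun setT v -> measurable_fun setT (fun x => h (u x) (v x)).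
Proof.
by move=> mh mu mv; exact: (measurableT_comp (mh n) (measurable_fun_pair mu mv)).
Qed.

Lemma seq_measurable_cons h x : seq_measurable h -> seq_measurable (fun y s => h y (x :: s)).
Proof.
move=> mh n; apply: (seq_measurable_comp h n.+1 fst (fun p : T * n.-tuple T => [tuple of x :: p.2])) => //.
exact: measurable_cons.
Qed.

Lemma measurable_sum_tuple h n : seq_measurable h ->
  measurable_fun setT (fun t : n.-tuple T => \sum_(y <- t) h y t)%E.
Proof.
move=> mh; under eq_fun do rewrite big_tuple.
apply: emeasurable_sum => i.
apply: (seq_measurable_comp h n (fun t => tnth t i) id) => //.
exact: measurable_tnth.
Qed.

(* Mecke's formula *)
Lemma integral_sum_tuple n (h : T -> seq T -> \bar R) :
  seq_measurable h -> (forall y s, 0 <= h y s)%E ->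
  (forall y s s', perm_eq s s' -> h y s = h y s') ->
  (\int[iid P n.+1]_t (\sum_(y <- t) h y t) =
   n.+1%:R%:E * \int[P]_y \int[iid P n]_t h y (y :: t))%E.
Proof.
have m2 k h' : seq_measurable h' ->
    measurable_fun setT (fun p : T * k.-tuple T => h' p.1 (p.1 :: p.2)).
  move=> mh'; apply: (seq_measurable_comp h' k.+1 fst (fun p : T * k.-tuple T => [tuple of p.1 :: p.2])) => //.
  exact: measurable_cons.
elim: n h => [|n ih] h mh h0 hP.
  rewrite mul1e integral_iidS; first last.
  - by move=> t; exact: sume_ge0.
  - exact: measurable_sum_tuple.
  apply: eq_integral => x _; apply: eq_integral => t _.
  by rewrite tuple0 /= big_seq1.
rewrite integral_iidS; first last.
- by move=> t; exact: sume_ge0.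
- exact: measurable_sum_tuple.
(* The head gives the first term, the induction hypothesis with prefix x the second. After Tonelli
   the latter is n + 1 copies of the former, the symmetry of [h] having moved y in front of x. *)
transitivity (\int[P]_x (\int[iid P n.+1]_t h x (x :: t) +
    n.+1%:R%:E * \int[P]_y \int[iid P n]_t h y (y :: x :: t)))%E.
  apply: eq_integral => x _.
  under eq_integral do rewrite big_cons.
  rewrite ge0_integralD//; first last.
  - apply: (measurable_sum_tuple (fun y s => h y (x :: s))).
    exact: seq_measurable_cons.
  - by move=> t _; exact: sume_ge0.
  - apply: (seq_measurable_comp h n.+2 (cst x) (fun t : n.+1.-tuple T => [tuple of x :: t])) => //.
    exact: measurable_cons.
  congr (_ + _)%E; rewrite (ih (fun y s => h y (x :: s))) //.
  - congr (_ * _)%E; apply: eq_integral => y _; apply: eq_integral => t _.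
    by apply: hP; exact/permEl/(perm_catCA [:: x] [:: y]).
  - exact: seq_measurable_cons.
  - by move=> y s s' ss'; apply: hP; rewrite perm_cons.
have m3 : measurable_fun setT (fun p : (T * T) * n.-tuple T => h p.1.2 (p.1.2 :: p.1.1 :: p.2)).
  apply: (seq_measurable_comp h n.+2 (fun p : (T * T) * n.-tuple T => p.1.2)
    (fun p => [tuple of p.1.2 :: p.1.1 :: p.2])) => //.
    by apply: measurableT_comp.
  apply: measurable_cons; first by apply: measurableT_comp => //.
  by apply: measurable_cons => //; apply: measurableT_comp.
pose Phi (p : T * T) : \bar R := (\int[iid P n]_t h p.2 (p.2 :: p.1 :: t))%E.
have mPhi : measurable_fun setT Phi.
  have : measurable_fun setT (fubini_F (iid P n)
      (fun p : (T * T) * n.-tuple T => h p.1.2 (p.1.2 :: p.1.1 :: p.2))).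
    by apply: measurable_fun_fubini_tonelli_F => // p; exact: h0.
  exact.
have Phi0 p : (0 <= Phi p)%E by apply: integral_ge0 => t _; exact: h0.
rewrite ge0_integralD//; first last.
- apply: emeasurable_funM => //.
  have : measurable_fun setT (fubini_F P Phi) by exact: measurable_fun_fubini_tonelli_F.
  exact.
- move=> x _; apply: mule_ge0 => //; apply: integral_ge0 => y _.
  by apply: integral_ge0.
- have : measurable_fun setT (fubini_F (iid P n.+1)
      (fun p : T * n.+1.-tuple T => h p.1 (p.1 :: p.2))).
    by apply: measurable_fun_fubini_tonelli_F => [|p]; [exact: m2|exact: h0].
  exact.
- by move=> x _; exact: integral_ge0.
rewrite ge0_integralZl_EFin//; first last.
- have : measurable_fun setT (fubini_F P Phi) by exact: measurable_fun_fubini_tonelli_F.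
  exact.
- by move=> x _; apply: integral_ge0 => y _; exact: integral_ge0.
rewrite (fubini_tonelli (m1 := P) (m2 := P) Phi)//.
rewrite -[X in (X + _)%E]mul1e.
rewrite [X in (_ + _ * X)%E](_ : _ = \int[P]_x \int[iid P n.+1]_t h x (x :: t))%E.
  rewrite -ge0_muleDl//.
apply: eq_integral => y _; rewrite integral_iidS//.
apply: (seq_measurable_comp h n.+2 (cst y) (fun t : n.+1.-tuple T => [tuple of y :: t])) => //.
exact: measurable_cons.
Qed.

End iid_tuples.

(** * Counts and total excess over a fixed threshold *)

Section threshold_counts.
Context {R : realType}.
Local Notation expo := (std_exponential R).
Implicit Types (y x s : R) (C : set R).

Definition num_ge y (l : seq R) : nat := count (fun x => y <= x) l.

Definition excess y (l : seq R) : R := \sum_(x <- l) Num.max 0 (x - y).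

Lemma num_ge_cons y x l : num_ge y (x :: l) = ((y <= x)%R + num_ge y l)%N.
Proof. by []. Qed.

Lemma excess_cons y x l : excess y (x :: l) = Num.max 0 (x - y) + excess y l.
Proof. by rewrite /excess big_cons. Qed.

Lemma num_ge_perm y l l' : perm_eq l l' -> num_ge y l = num_ge y l'.
Proof. by move/permP; apply. Qed.

Lemma excess_perm y l l' : perm_eq l l' -> excess y l = excess y l'.
Proof. by move=> h; exact: perm_big. Qed.

Section measurability.
Context {d} {T : measurableType d} {n : nat} (u : T -> R) (v : T -> n.-tuple R).
Hypotheses (mu : measurable_fun setT u) (mv : measurable_fun setT v).

Let measurable_tnth_v i : measurable_fun setT (fun w => tnth (v w) i).
Proof. exact: (measurableT_comp (measurable_tnth i)). Qed.

Lemma measurable_num_ge : measurable_fun setT (fun w => (num_ge (u w) (v w))%:R : R).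
Proof.
rewrite (_ : (fun w => _) = (fun w => \sum_(i < n) (if u w <= tnth (v w) i then 1 else 0))).
  apply: measurable_sum => i; apply: measurable_fun_ifT => //.
  exact: measurable_fun_ler.
apply/funext => w; rewrite /num_ge -sum1_count natr_sum big_mkcond /= big_tuple.
by apply: eq_bigr => i _; case: ifP.
Qed.

Lemma measurable_num_ge_eq m : measurable [set w | num_ge (u w) (v w) = m].
Proof.
rewrite (_ : [set _ | _] = (fun w => (num_ge (u w) (v w))%:R : R) @^-1` [set m%:R]).
  by rewrite -[X in measurable X]setTI; exact: measurable_num_ge.
by apply/seteqP; split => x /= => [->//|/eqP]; rewrite eqr_nat => /eqP.
Qed.

Lemma measurable_num_ge_ge m : measurable [set w | (m <= num_ge (u w) (v w))%N].
Proof.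
rewrite (_ : [set _ | _] = (fun w => (num_ge (u w) (v w))%:R : R) @^-1` `[m%:R, +oo[%classic).
  by rewrite -[X in measurable X]setTI; exact: measurable_num_ge.
by apply/seteqP; split => x /=; rewrite in_itv/= andbT ler_nat.
Qed.

Lemma measurable_excess : measurable_fun setT (fun w => excess (u w) (v w)).
Proof.
rewrite /excess; under eq_fun do rewrite big_tuple.
apply: measurable_sum => i; apply: measurable_maxr => //.
exact: measurable_funB.
Qed.

Lemma measurable_excess_in C : measurable C -> measurable [set w | C (excess (u w) (v w))].
Proof. by move=> mC; rewrite -[X in measurable X]setTI; exact: measurable_excess. Qed.

Lemma measurable_sum_seq : measurable_fun setT (fun w => \sum_(z <- v w) z : R).
Proof. by under eq_fun do rewrite big_tuple; exact: measurable_sum. Qed.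

End measurability.

(** The Gamma(m) law as the law of a sum of m independent Exp(1) variables (the point mass at 0 if m
    = 0), so that its properties can be obtained coordinate by coordinate. *)
Definition gamma_law m C := iid expo m [set t : m.-tuple R | C (\sum_(x <- t) x)].

Lemma measurable_sum_in m C : measurable C -> measurable [set t : m.-tuple R | C (\sum_(x <- t) x)].
Proof.
by move=> mC; rewrite -[X in measurable X]setTI; apply: measurable_sum_seq.
Qed.

Lemma gamma_lawT m : gamma_law m setT = 1%E.
Proof.
rewrite /gamma_law (_ : [set _ | _] = setT) ?probability_setT//.
Qed.

Lemma measurable_sub C y : measurable C -> measurable [set z | C (y + z)].
Proof.
move=> mC; rewrite -[X in measurable X]setTI.
have : measurable_fun [set: R] (fun z => y + z) by exact: measurable_funD.
exact.
Qed.

Lemma gamma_lawS m C : measurable C ->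
  gamma_law m.+1 C = (\int[expo]_x gamma_law m [set z | C (x + z)%R])%E.
Proof.
move=> mC; rewrite /gamma_law iidS; last exact: measurable_sum_in.
by apply: eq_integral => x _; congr (iid expo m _); apply/seteqP; split => t /=; rewrite big_cons.
Qed.

Lemma measurable_gamma_law m C : measurable C ->
  measurable_fun setT (fun x => gamma_law m [set z | C (x + z)]).
Proof.
move=> mC.
pose A := [set p : R * m.-tuple R | C (p.1 + \sum_(x <- p.2) x)].
have mA : measurable A.
  rewrite -[X in measurable X]setTI.
  have : measurable_fun setT (fun p : R * m.-tuple R => p.1 + \sum_(x <- p.2) x).
    by apply: measurable_funD => //; exact: measurable_sum_seq.
  exact.
have := measurable_fun_xsection (iid expo m) mA.
rewrite (_ : _ \o _ = (fun x => gamma_law m [set z | C (x + z)]))//.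
apply/funext => x /=; congr (iid expo m _).
by apply/seteqP; split => t /=; rewrite xsectionE.
Qed.

(** [std_exponential_scale] applied to every coordinate: the tilting factors multiply to a function
    of the sum alone. *)
Lemma integral_iid_sum_scale m s (g : R -> \bar R) : 0 < s ->
  measurable_fun setT g -> (forall x, 0 <= g x)%E ->
  (\int[iid expo m]_t g (\sum_(x <- t) x)%R = (s ^+ m)%:E *
   \int[iid expo m]_t ((expR (- (s - 1) * \sum_(x <- t) x))%:E * g (s * \sum_(x <- t) x)%R))%E.
Proof.
move=> s0.
have mE k (g' : R -> \bar R) (a b : R) : measurable_fun setT g' ->
  measurable_fun setT (fun t : k.-tuple R => g' (a + b * \sum_(x <- t) x)%R).
  move=> mg'; apply: (measurableT_comp mg'); apply: measurable_funD => //.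
  by apply: measurable_funM => //; exact: measurable_sum_seq.
have mH k (g' : R -> \bar R) (a : R) : measurable_fun setT g' ->
  measurable_fun setT (fun t : k.-tuple R =>
    ((expR (- (s - 1) * \sum_(x <- t) x))%:E * g' (a + s * \sum_(x <- t) x)%R)%E).
  move=> mg'; apply: emeasurable_funM; last exact: mE.
  apply/measurable_EFinP/measurableT_comp => //; apply: measurable_funM => //.
  exact: measurable_sum_seq.
have mid k (g' : R -> \bar R) : measurable_fun setT g' ->
    measurable_fun setT (fun t : k.-tuple R => g' (\sum_(x <- t) x)%R).
  by move=> mg'; apply: (measurableT_comp mg'); exact: measurable_sum_seq.
have mK k (g' : R -> \bar R) : measurable_fun setT g' ->
  measurable_fun setT (fun t : k.-tuple R =>
    ((expR (- (s - 1) * \sum_(x <- t) x))%:E * g' (s * \sum_(x <- t) x)%R)%E).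
  by move=> /(mH k _ 0); under eq_fun do rewrite add0r.
elim: m g => [|m ih] g mg g0.
  by rewrite !integral_iid0 ?big_nil ?mulr0 ?expR0 ?mul1e//; [exact: mK|exact: mid].
rewrite integral_iidS//; last exact: mid.
pose G x := (\int[iid expo m]_t ((expR (- (s - 1) * \sum_(x <- t) x))%:E *
    g (x + s * \sum_(x <- t) x)%R))%E.
have G0 x : (0 <= G x)%E by apply: integral_ge0 => t _; rewrite mule_ge0// lee_fin expR_ge0.
have mG : measurable_fun setT G.
  have : measurable_fun setT (fubini_F (iid expo m) (fun p : R * m.-tuple R =>
      ((expR (- (s - 1) * \sum_(x <- p.2) x))%:E * g (p.1 + s * \sum_(x <- p.2) x)%R)%E)).
    apply: measurable_fun_fubini_tonelli_F => [|p]; last by rewrite mule_ge0// lee_fin expR_ge0.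
    have mS : measurable_fun setT (fun p : R * m.-tuple R => \sum_(x <- p.2) x).
      exact: measurable_sum_seq.
    apply: emeasurable_funM.
      by apply/measurable_EFinP/measurableT_comp => //; exact: measurable_funM.
    apply: (measurableT_comp mg); apply: measurable_funD => //.
    exact: measurable_funM.
  exact.
transitivity (\int[expo]_x ((s ^+ m)%:E * G x))%E.
  apply: eq_integral => x _.
  under eq_integral do rewrite big_cons.
  rewrite (ih (fun z => g (x + z)))//.
  by apply: (measurableT_comp mg); exact: measurable_funD.
rewrite ge0_integralZl_EFin//; last by rewrite exprn_ge0// ltW.
rewrite (std_exponential_scale _ s)// muleA -EFinM -exprSr; congr (_ * _)%E.
rewrite [RHS]integral_iidS; first last.
- by move=> t; rewrite mule_ge0// lee_fin expR_ge0.
- exact: mK.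
apply: eq_integral => x _; rewrite -ge0_integralZl_EFin ?expR_ge0//; last 2 first.
- by move=> t _; rewrite mule_ge0// lee_fin expR_ge0.
- exact: mH.
apply: eq_integral => t _; rewrite /= big_cons muleA -EFinM -expRD -!mulrDr.
by [].
Qed.

(** The count over y is binomial and, given that it equals m, the excess is Gamma(m). Induction on
    n: a first coordinate below y changes nothing, one above y adds an Exp(1) excess by lack of
    memory, and Pascal's rule joins the two cases. *)
Lemma iid_num_ge_excess n y m C : 0 <= y -> measurable C ->
  iid expo n [set t : n.-tuple R | num_ge y t = m /\ C (excess y t)] =
  (('C(n, m)%:R * expR (- y) ^+ m * (1 - expR (- y)) ^+ (n - m))%:E * gamma_law m C)%E.
Proof.
move=> y0; set p := expR (- y).
have mI k j C' : measurable C' ->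
    measurable [set t : k.-tuple R | num_ge y t = j /\ C' (excess y t)].
  move=> mC'; apply: measurableI.
    exact: (measurable_num_ge_eq (cst y) id).
  exact: (measurable_excess_in (cst y) id).
have p0 : 0 <= p by exact: expR_ge0.
have p1 : p <= 1 by rewrite -expR0 ler_expR oppr_le0.
have a0 k j : 0 <= 'C(k, j)%:R * p ^+ j * (1 - p) ^+ (k - j).
  by rewrite !mulr_ge0// exprn_ge0// subr_ge0.
elim: n m C => [|n ih] m C mC.
  rewrite /= diracE /gamma_law; case: m => [|m].
    rewrite bin0 !expr0 !mul1r mul1e /= diracE; congr ((nat_of_bool _)%:R%:E).
    apply/idP/idP; rewrite !inE /= /excess !big_nil/=.
      by move=> -[].
    by split.
  by rewrite bin0n !mul0r mul0e memNset//= => -[].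
rewrite iidS//; last exact: mI.
have mD : measurable [set z : R | y <= z] by rewrite -set_itvcy.
have mD' : measurable [set z : R | z < y] by rewrite -set_itvNyo.
pose c j := 'C(n, j)%:R * p ^+ j * (1 - p) ^+ (n - j).
pose F j x := gamma_law j [set z | C (x + z)].
transitivity (\int[expo]_x (((c m)%:E * gamma_law m C) * (\1_[set z : R | (z < y)%R] x)%:E +
    (if m is j.+1 then (c j)%:E * ((\1_[set z : R | (y <= z)%R] x)%:E * F j (x - y)%R) else 0)))%E.
  apply: eq_integral => x _; rewrite !indicE.
  case: (leP y x) => yx.
    rewrite memNset /=; last by rewrite ltNge yx.
    rewrite mule0 add0e.
    case: m => [|m].
      rewrite (_ : [set _ | _] = set0) ?measure0//.
      by apply/seteqP; split => // t /=; rewrite ?num_ge_cons yx => -[].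
    rewrite mem_set// mul1e -ih; last exact: measurable_sub.
    congr (iid expo n _); apply/seteqP; split => t /=; rewrite ?num_ge_cons yx excess_cons.
      by rewrite max_r ?subr_ge0// => -[[<-]].
    by rewrite max_r ?subr_ge0// => -[->].
  rewrite mem_set// mule1 [X in (_ + X)%E](_ : _ = 0%E); last first.
    case: (m) => // j; rewrite memNset /=; last by rewrite leNgt yx.
    by rewrite mul0e mule0.
  rewrite adde0 -ih//.
  congr (iid expo n _); apply/seteqP; split => t /=; rewrite ?num_ge_cons excess_cons leNgt yx.
    by rewrite max_l ?add0r// subr_le0 ltW.
  by rewrite max_l ?add0r// subr_le0 ltW.
have mF j : measurable_fun setT (F j) by exact: measurable_gamma_law.
rewrite ge0_integralD//; first last.
- case: m => // m; apply: emeasurable_funM => //; apply: emeasurable_funM.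
    by apply/measurable_EFinP/measurable_indic.
  by apply: (measurableT_comp (mF m)); exact: measurable_funB.
- by case: m => // m x _; rewrite mule_ge0 ?lee_fin ?a0// mule_ge0 ?lee_fin.
- apply: emeasurable_funM => //; exact/measurable_EFinP/measurable_indic.
- by move=> x _; rewrite mule_ge0 ?lee_fin// mule_ge0 ?lee_fin ?a0.
have gfin j : gamma_law j C \is a fin_num by rewrite fin_num_measure//; exact: measurable_sum_in.
have exlt : (\int[expo]_x (\1_[set z : R | (z < y)%R] x)%:E = (1 - p)%:E)%E.
  rewrite integral_indic// setIT (_ : [set z | z < y] = ~` [set z | y <= z]).
    have := probability_setC expo mD; rewrite std_exponential_ge//; exact.
  by apply/seteqP; split => z /=; rewrite ltNge => /negP.
rewrite ge0_integralZl//; first last.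
- by rewrite mule_ge0 ?lee_fin ?a0.
- exact/measurable_EFinP/measurable_indic.
rewrite exlt.
case: m => [|m].
  rewrite integral0 adde0 /c !bin0 !expr0 !subn0 !mul1r -/(gamma_law 0 C) muleAC.
  by rewrite -EFinM exprSr.
rewrite ge0_integralZl_EFin ?a0//; first last.
- apply: emeasurable_funM; first exact/measurable_EFinP/measurable_indic.
  by apply: (measurableT_comp (mF m)); exact: measurable_funB.
- by move=> x _; rewrite mule_ge0 ?lee_fin.
rewrite std_exponential_memoryless// -?gamma_lawS//.
rewrite muleAC -EFinM muleA -EFinM -ge0_muleDl ?lee_fin ?mulr_ge0 ?exprn_ge0 ?subr_ge0//.
congr (_ * _)%E; rewrite -EFinD; congr EFin; rewrite /c -/p binS natrD exprS subSS.
(* Subtraction is truncated: if n <= m, the exponent n - m.+1 does not gain 1 from the extra factor,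
   but its binomial coefficient vanishes. *)
have [mn|mn] := leqP m.+1 n.
  by rewrite -!(subnSK mn) exprS; ring.
by rewrite bin_small// !mul0r add0r add0r; ring.
Qed.

End threshold_counts.

(** * Large deviations of Gamma and binomial laws *)

Section gamma_tails.
Context {R : realType}.
Local Notation expo := (std_exponential R).
Implicit Types (C : set R) (s r : R).

Lemma gamma_lawE m C : measurable C ->
  gamma_law m C = (\int[iid expo m]_t (\1_C (\sum_(x <- t) x)%R)%:E)%E.
Proof.
move=> mC; rewrite /gamma_law -[X in iid expo m X]setIT -integral_indic//.
exact: measurable_sum_in.
Qed.

Let mtilt m s C : measurable C -> measurable_fun setT (fun t : m.-tuple R =>
  ((expR (- (s - 1) * \sum_(x <- t) x))%:E * (\1_C (s * \sum_(x <- t) x)%R)%:E)%E).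
Proof.
move=> mC; apply: emeasurable_funM; apply/measurable_EFinP.
  by apply: measurableT_comp => //; apply: measurable_funM => //; exact: measurable_sum_seq.
apply: measurableT_comp; first exact: measurable_indic.
by apply: measurable_funM => //; exact: measurable_sum_seq.
Qed.

Let gamma_law_tilt m s C : 0 < s -> measurable C -> (gamma_law m C = (s ^+ m)%:E *
  \int[iid expo m]_t ((expR (- (s - 1) * \sum_(x <- t) x))%:E *
                      (\1_C (s * \sum_(x <- t) x)%R)%:E))%E.
Proof.
move=> s0 mC; rewrite gamma_lawE//.
rewrite (integral_iid_sum_scale m s (fun x => (\1_C x)%:E))//.
exact/measurable_EFinP/measurable_indic.
Qed.

(** After tilting by s, the condition on C bounds the density by its value at sum k. The sign of s -
    1 decides the tail: z >= k s when s > 1, z <= k s when s < 1. *)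
Lemma gamma_law_le m s (k : R) C : 0 < s -> measurable C ->
  (forall z, C z -> 0 <= (s - 1) * (z - k * s)) ->
  (gamma_law m C <= (s ^+ m * expR (- (s - 1) * k))%:E)%E.
Proof.
move=> s0 mC hC; rewrite (gamma_law_tilt m s)// EFinM lee_pmul2l ?lte_fin ?exprn_gt0//.
apply: (@le_trans _ _ (\int[iid expo m]_t cst (expR (- (s - 1) * k))%:E t)%E).
  apply: ge0_le_integral => //.
    exact: mtilt.
  move=> t _; rewrite indicE -EFinM lee_fin.
  have [/set_mem Ct|_] := boolP (_ \in C); last by rewrite mulr0 expR_ge0.
  rewrite mulr1 ler_expR; have := hC _ Ct.
  rewrite [k * s]mulrC -mulrBr mulrCA pmulr_rge0//; lra.
rewrite integral_cst// [X in (_ * X)%E](_ : _ = 1%E) ?mule1//; exact: probability_setT.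
Qed.

(** Under the tilted law the sum sits near k when the original one sits near k s; on a window of
    radius r the density loses at most the factor exp (- |s - 1| r). *)
Lemma gamma_law_ge m s (k r : R) C : 0 < s -> measurable C ->
  (forall z, `|z - k * s| <= r * s -> C z) ->
  ((s ^+ m * expR (- (s - 1) * k - `|s - 1| * r))%:E *
   gamma_law m [set z | (`|z - k| <= r)%R] <= gamma_law m C)%E.
Proof.
move=> s0 mC hC.
have mr : measurable [set z : R | `|z - k| <= r].
  rewrite -[X in measurable X]setTI; apply: measurable_fun_le => //.
  by apply: measurableT_comp => //; exact: measurable_funB.
rewrite (gamma_law_tilt m s C)// EFinM -muleA lee_pmul2l ?lte_fin ?exprn_gt0//.
rewrite gamma_lawE// -ge0_integralZl_EFin ?expR_ge0//; last first.
  apply/measurable_EFinP/measurableT_comp; first exact: measurable_indic.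
  exact: measurable_sum_seq.
apply: ge0_le_integral => //.
- apply: emeasurable_funM => //.
  apply/measurable_EFinP/measurableT_comp; first exact: measurable_indic.
  exact: measurable_sum_seq.
- exact: mtilt.
move=> t _; rewrite !indicE -!EFinM lee_fin.
have [/set_mem /= tr|_] := boolP (\sum_(x <- t) x \in [set z : R | `|z - k| <= r]); last first.
  by rewrite mulr0 mulr_ge0// expR_ge0.
rewrite mem_set; last first.
  apply: hC; rewrite [k * s]mulrC -mulrBr normrM (gtr0_norm s0) [leRHS]mulrC.
  by rewrite ler_pM2l.
rewrite !mulr1 ler_expR.
have : (s - 1) * (\sum_(x <- t) x - k) <= `|s - 1| * r.
  by rewrite (le_trans (ler_norm _))// normrM ler_wpM2l.
lra.
Qed.

(** The excess has k - 1 summands while its natural centre is k s; the mismatch is the factor 1 /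
    s. *)
Lemma chernoff_rateE s k : 0 < s -> (0 < k)%N ->
  s ^+ k.-1 * expR (- (s - 1) * k%:R) = s^-1 * expR (- (k%:R * rate_fun (1 - s))).
Proof.
move=> s0 k0.
have -> : expR (- (k%:R * rate_fun (1 - s))) = s ^+ k * expR (- (s - 1) * k%:R).
  rewrite -[in RHS](lnK (x := s)) ?posrE// -expRM_natl -expRD; congr expR.
  by rewrite /rate_fun lnK ?posrE// opprB addrCA subrr addr0 mulr_natl; ring.
by rewrite -(prednK k0) exprS mulrA mulrA mulVf ?mul1r// gt_eqF.
Qed.

(** Two Chernoff bounds suffice, each tail being at most 1 / 4. *)
Lemma gamma_law_concentration k : (256 <= k)%N ->
  ((2^-1)%:E <= gamma_law k.-1 [set z : R | (`|z - k%:R| <= 8 * Num.sqrt k%:R)%R])%E.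
Proof.
move=> k256; have k0 : (0 < k)%N by apply: leq_trans k256.
set w : R := Num.sqrt k%:R.
have w16 : 16 <= w.
  by rewrite /w (_ : 16 = Num.sqrt (256%:R)) ?ler_wsqrtr ?ler_nat// (_ : 256%:R = 16 ^+ 2) ?sqrtr_sqr ?ger0_norm//; ring.
have ww : k%:R = w * w :> R by rewrite -expr2 sqr_sqrtr.
(* The relative radius of the window: k x = 8 sqrt k and k x^2 = 64, while k >= 256 gives x <= 1 /
   2, so the quadratic lower bound on f makes both exponents at least 12. *)
pose x : R := 8 / w.
have x0 : 0 < x by rewrite divr_gt0//; lra.
have x2 : x <= 2^-1 by rewrite ler_pdivrMr; lra.
have wx : w * x = 8 by rewrite /x; field; lra.
have kx : k%:R * x = 8 * w by rewrite ww -mulrA wx mulrC.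
have kxx : k%:R * x ^+ 2 = 64.
  rewrite (_ : k%:R * x ^+ 2 = 8 * (w * x)); last by rewrite expr2 mulrA kx mulrA.
  by rewrite wx; ring.
pose A : set R := `[k%:R * (1 + x), +oo[%classic.
pose B : set R := `]-oo, k%:R * (1 - x)]%classic.
have mA : measurable A by exact: measurable_itv.
have mB : measurable B by exact: measurable_itv.
have hA : (gamma_law k.-1 A <= (4^-1)%:E)%E.
  apply: (le_trans (gamma_law_le k.-1 (1 + x) k%:R A _ _ _)) => //.
  - lra.
  - by move=> z; rewrite /A/= in_itv/= andbT => ?; rewrite mulr_ge0 ?subr_ge0//; lra.
  rewrite chernoff_rateE//; last by lra.
  have xN : - x < 1 by lra.
  have := rate_fun_ge_sqr (- x) xN; rewrite sqrrN opprK => hf.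
  rewrite (_ : 1 - (1 + x) = - x); last by ring.
  have h1 : 12 <= k%:R * rate_fun (- x).
    apply: (@le_trans _ _ (k%:R * (x ^+ 2 / (2 * (2 + x))))); last by rewrite ler_wpM2l.
    by rewrite mulrA kxx ler_pdivlMr; lra.
  have h2 : expR (- (k%:R * rate_fun (- x))) <= 4^-1.
    rewrite expRN lef_pV2 ?posrE ?expR_gt0//.
    have := expR_ge1Dx (k%:R * rate_fun (- x)); lra.
  rewrite lee_fin -[leRHS]mul1r ler_pM ?expR_ge0 ?invr_ge0//; first by lra.
  by rewrite invf_le1; lra.
have hB : (gamma_law k.-1 B <= (4^-1)%:E)%E.
  apply: (le_trans (gamma_law_le k.-1 (1 - x) k%:R B _ _ _)) => //.
  - lra.
  - by move=> z; rewrite /B/= in_itv/= => ?; rewrite -mulrNN mulr_ge0// oppr_ge0 ?subr_le0//; lra.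
  rewrite chernoff_rateE//; last by lra.
  have xN : x < 1 by lra.
  have hf := rate_fun_ge_sqr x xN.
  rewrite (_ : 1 - (1 - x) = x); last by ring.
  have h1 : 12 <= k%:R * rate_fun x.
    apply: (@le_trans _ _ (k%:R * (x ^+ 2 / (2 * (2 - x))))); last by rewrite ler_wpM2l.
    by rewrite mulrA kxx ler_pdivlMr; lra.
  (* Here the prefactor 1 / (1 - x) may reach 2, so 1 / 8 is required instead of 1 / 4. *)
  have h2 : expR (- (k%:R * rate_fun x)) <= 8^-1.
    rewrite expRN lef_pV2 ?posrE ?expR_gt0//.
    have := expR_ge1Dx (k%:R * rate_fun x); lra.
  rewrite lee_fin (_ : 4^-1 = 2 * 8^-1); last by field.
  rewrite ler_pM ?expR_ge0 ?invr_ge0//; first by lra.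
  by rewrite invf_ple ?posrE; lra.
set D := [set z : R | _].
have DE : D = ~` [set z : R | (8 * w < `|z - k%:R|)].
  by apply/seteqP; split => z; rewrite /D /= leNgt => /negP.
have mD : measurable D.
  rewrite -[X in measurable X]setTI; apply: measurable_fun_le => //.
  by apply: measurableT_comp => //; exact: measurable_funB.
have mS C : measurable C -> measurable [set t : k.-1.-tuple R | C (\sum_(x <- t) x)].
  exact: measurable_sum_in.
have : (1 <= gamma_law k.-1 D + (gamma_law k.-1 A + gamma_law k.-1 B))%E.
  rewrite -(gamma_lawT k.-1) /gamma_law.
  set E1 := [set t : k.-1.-tuple R | D (\sum_(x <- t) x)%R].
  set E2 := [set t : k.-1.-tuple R | A (\sum_(x <- t) x)%R].
  set E3 := [set t : k.-1.-tuple R | B (\sum_(x <- t) x)%R].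
  have m1 : measurable E1 by exact: mS.
  have m2 : measurable E2 by exact: mS.
  have m3 : measurable E3 by exact: mS.
  have m23 : measurable (E2 `|` E3) by exact: measurableU.
  apply: (@le_trans _ _ (iid expo k.-1 (E1 `|` (E2 `|` E3)))%E).
    apply: le_measure; rewrite ?inE; [exact: mS|exact: measurableU|].
    move=> t _; rewrite /E1 /E2 /E3 /A /B /D/= !in_itv/= andbT.
    set z := \sum_(x <- t) x.
    have [h|h] := leP `|z - k%:R| (8 * w); first by left.
    right; move: h; rewrite ltr_normr => /orP[] h; [left|right]; lra.
  have h1 := measureU2 (iid expo k.-1) m1 m23.
  apply: (le_trans h1).
  by rewrite leeD2l// measureU2.
have Dfin : gamma_law k.-1 D \is a fin_num by rewrite fin_num_measure//; exact: mS.
move=> h; have : (1 <= gamma_law k.-1 D + (4^-1 + 4^-1)%:E)%E.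
  by apply: (le_trans h); rewrite leeD2l// EFinD leeD.
rewrite -(fineK Dfin) -EFinD !lee_fin; lra.
Qed.

Lemma integral_expR_num_ge n y a : 0 <= y -> 0 <= a ->
  (\int[iid expo n]_t (expR (- (a * (num_ge y t)%:R)))%:E =
   ((1 - expR (- y) * (1 - expR (- a))) ^+ n)%:E)%E.
Proof.
move=> y0 a0.
have mE k : measurable_fun setT (fun t : k.-tuple R => (expR (- (a * (num_ge y t)%:R)))%:E).
  apply/measurable_EFinP/measurableT_comp => //; apply: measurableT_comp => //.
  by apply: measurable_funM => //; exact: (measurable_num_ge (cst y) id).
have mD : measurable [set z : R | y <= z] by rewrite -set_itvcy.
set p := expR (- y); have p0 : 0 <= p by exact: expR_ge0.
have p1 : p <= 1 by rewrite -expR0 ler_expR oppr_le0.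
have ea1 : expR (- a) <= 1 by rewrite -expR0 ler_expR oppr_le0.
have q0 : 0 <= 1 - p * (1 - expR (- a)).
  by have := expR_ge0 (- a); nra.
elim: n => [|n ih].
  rewrite integral_iid0//=; last exact: mE.
  by rewrite /num_ge/= mulr0 oppr0 expR0 expr0.
rewrite integral_iidS//; last exact: mE.
transitivity (\int[expo]_x (((1 - p * (1 - expR (- a))) ^+ n)%:E *
    (expR (- (a * (y <= x)%R%:R)))%:E))%E.
  apply: eq_integral => x _; rewrite -ih -ge0_integralZr//; last exact: mE.
  apply: eq_integral => t _; by rewrite /= ?num_ge_cons natrD mulrDr opprD expRD EFinM muleC.
have mI : measurable_fun setT (fun x : R => (expR (- (a * (y <= x)%R%:R)))%:E).
  rewrite (_ : (fun x => _) = (fun x => (expR (- (a * \1_[set z : R | y <= z] x)))%:E)).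
    apply/measurable_EFinP/measurableT_comp => //; apply: measurableT_comp => //.
    by apply: measurable_funM => //; exact: measurable_indic.
  by apply/funext => x; rewrite indicE mem_setE.
rewrite ge0_integralZl_EFin ?exprn_ge0//.
rewrite exprSr EFinM; congr (_ * _)%E.
transitivity (\int[expo]_x ((expR (- a) * \1_[set z : R | (y <= z)%R] x)%:E +
    (\1_[set z : R | (z < y)%R] x)%:E))%E.
  apply: eq_integral => x _; rewrite !indicE -EFinD; case: (leP y x) => yx.
    rewrite mem_set// memNset/=; last by rewrite ltNge yx.
    by rewrite !mulr1 addr0.
  rewrite memNset/=; last by rewrite leNgt yx.
  by rewrite mem_set// !mulr0 oppr0 expR0 add0r.
have mD' : measurable [set z : R | z < y] by rewrite -set_itvNyo.
rewrite ge0_integralD//; first last.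
- exact/measurable_EFinP/measurable_indic.
- by apply/measurable_EFinP/measurable_funM => //; exact: measurable_indic.
under eq_integral do rewrite EFinM.
rewrite ge0_integralZl_EFin ?expR_ge0//; last exact/measurable_EFinP/measurable_indic.
have -> : (\int[expo]_x (\1_[set z : R | (y <= z)%R] x)%:E = p%:E)%E.
  by rewrite integral_indic// setIT; exact: std_exponential_ge.
have -> : (\int[expo]_x (\1_[set z : R | (z < y)%R] x)%:E = (1 - p)%:E)%E.
  rewrite integral_indic// setIT (_ : [set z | z < y] = ~` [set z | y <= z]).
    have := probability_setC expo mD; rewrite std_exponential_ge//; exact.
  by apply/seteqP; split => z /=; rewrite ltNge => /negP.
by rewrite -EFinM -EFinD; congr EFin; ring.
Qed.

(** Chernoff's bound for a binomial count of mean q k. The exponent a = ln q is optimal after 1 - u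
    is bounded by exp (- u). *)
Lemma num_ge_chernoff n k (y q : R) : 0 <= y -> 1 <= q ->
  n%:R * expR (- y) = q * k%:R ->
  (iid expo n [set t : n.-tuple R | (num_ge y t < k)%N] <=
   (expR (- (k%:R * rate_fun (1 - q))))%:E)%E.
Proof.
move=> y0 q1 npE; have q0 : 0 < q by lra.
pose a := ln q; have a0 : 0 <= a by exact: ln_ge0.
have mE : measurable_fun setT (fun t : n.-tuple R => (expR (- (a * (num_ge y t)%:R)))%:E).
  apply/measurable_EFinP/measurableT_comp => //; apply: measurableT_comp => //.
  by apply: measurable_funM => //; exact: (measurable_num_ge (cst y) id).
have mS : measurable [set t : n.-tuple R | (num_ge y t < k)%N].
  rewrite (_ : [set _ | _] = ~` [set t : n.-tuple R | (k <= num_ge y t)%N]).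
    by apply: measurableC; exact: (measurable_num_ge_ge (cst y) id).
  by apply/seteqP; split => t /=; rewrite ltnNge => /negP.
rewrite -[X in iid expo n X]setIT -integral_indic//.
apply: (@le_trans _ _ (\int[iid expo n]_t ((expR (a * k%:R))%:E * (expR (- (a * (num_ge y t)%:R)))%:E))%E).
  apply: ge0_le_integral => //.
  - exact/measurable_EFinP/measurable_indic.
  - exact: emeasurable_funM.
  move=> t _; rewrite -EFinM -expRD lee_fin indicE.
  have [/set_mem /= h|_] := boolP (_ \in _); last exact: expR_ge0.
  by rewrite -[leLHS]expR0 ler_expR -mulrBr mulr_ge0// subr_ge0 ler_nat ltnW.
rewrite ge0_integralZl_EFin ?expR_ge0//.
rewrite integral_expR_num_ge// -EFinM lee_fin.
have eaq : expR (- a) = q^-1 by rewrite expRN lnK.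
set p := expR (- y); have p0 : 0 <= p by exact: expR_ge0.
have p1 : p <= 1 by rewrite -expR0 ler_expR oppr_le0.
have qi : 0 < q^-1 <= 1 by rewrite invr_gt0 q0/= invf_le1.
apply: (@le_trans _ _ (expR (a * k%:R) * (expR (- (p * (1 - expR (- a))))) ^+ n)).
  rewrite ler_wpM2l ?expR_ge0// eaq lerXn2r ?nnegrE ?expR_ge0//; first by nra.
  exact: expR_ge1Dx.
rewrite -expRM_natl -expRD ler_expR /rate_fun eaq.
have -> : n%:R * - (p * (1 - q^-1)) = - (k%:R * (q - 1)).
  by rewrite mulrN mulrA npE; field; lra.
by rewrite opprB addrCA subrr addr0 /a; lra.
Qed.

End gamma_tails.

(** * Order statistics of a list *)

Section order_statistics.
Context {R : realType}.
Implicit Types (l s : seq R) (a y : R).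
Definition ranked k l : R := nth 0 (sort (fun a b : R => b <= a) l) k.-1.

Let geR : rel R := fun a b => b <= a.
Let geR_total : total geR. Proof. by move=> x y; exact: le_total. Qed.
Let geR_trans : transitive geR. Proof. by move=> x y z /[swap]; exact: le_trans. Qed.
Let geR_anti : antisymmetric geR.
Proof. by move=> x y /andP[? ?]; apply/eqP; rewrite eq_le; apply/andP. Qed.

Let sortedR l : sorted geR (sort geR l). Proof. exact: sort_sorted. Qed.

Lemma ranked_le i j l : (0 < i)%N -> (i <= j)%N -> (j <= size l)%N -> ranked j l <= ranked i l.
Proof.
move=> i0 ij jl; apply: (sorted_leq_nth geR_trans _ 0 (sortedR l)).
- by move=> x; exact: lexx.
- by rewrite inE size_sort (leq_trans _ jl)// (leq_trans _ ij)// prednK.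
- by rewrite inE size_sort; case: j ij jl => [|//]; rewrite leqNgt i0.
- by rewrite -ltnS !prednK// (leq_trans _ ij).
Qed.

(** Turns events about an order statistic into events about a count, both for measurability and for
    Chernoff's bound. *)
Lemma le_ranked k l a : (0 < k)%N -> (k <= size l)%N ->
  (a <= ranked k l) = (k <= num_ge a l)%N.
Proof.
move=> k0 kl; have pl : perm_eq (sort geR l) l by rewrite perm_sort.
rewrite -(num_ge_perm a _ _ pl) /num_ge.
set s := sort geR l; have sz : size s = size l by rewrite size_sort.
apply/idP/idP => [ak|].
  rewrite -(cat_take_drop k s) count_cat (leq_trans _ (leq_addr _ _))//.
  have -> : count (fun x => a <= x) (take k s) = size (take k s).
    apply/eqP; rewrite -all_count; apply/(all_nthP 0) => i.
    rewrite size_takel ?sz// => ik; rewrite nth_take//.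
    by apply: (le_trans ak); apply: (ranked_le i.+1 k).
  by rewrite size_takel ?sz.
apply: contraLR; rewrite -ltNge -ltnNge => ka.
rewrite -(cat_take_drop k.-1 s) count_cat.
have -> : count (fun x => a <= x) (drop k.-1 s) = 0%N.
  apply/eqP; rewrite -leqn0 leqNgt -has_count; apply/hasPn => x /(nthP 0)[i].
  rewrite size_drop ltn_subRL sz nth_drop => il <-.
  rewrite -ltNge (le_lt_trans _ ka)//; apply: (ranked_le k (k.-1 + i).+1) => //.
  by case: (k) k0 => // m _ /=; rewrite ltnS leq_addr.
rewrite addn0 (leq_ltn_trans (count_size _ _))// size_takel ?prednK//.
by rewrite sz (leq_trans (leq_pred _)).
Qed.

Lemma ranked_in k l : (0 < k)%N -> (k <= size l)%N -> ranked k l \in l.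
Proof.
move=> k0 kl; rewrite -(mem_sort geR) mem_nth// size_sort.
by case: (k) k0 kl.
Qed.

(** Without ties, the position of an entry in the sorted list is the number of entries at least as
    large; this lets a sum over sample points pick out the k-th largest. *)
Lemma num_ge_uniq k l y : (0 < k)%N -> (k <= size l)%N -> uniq l -> y \in l ->
  (num_ge y l == k) = (y == ranked k l).
Proof.
move=> k0 kl ul; rewrite -(mem_sort geR) => /(nthP 0)[j].
rewrite size_sort => jl yE.
have us : uniq (sort geR l) by rewrite sort_uniq.
have numE : num_ge y l = j.+1.
  have h1 : (j.+1 <= num_ge y l)%N by rewrite -le_ranked//= -yE.
  apply/eqP; rewrite eqn_leq h1 andbT; have [jl2|] := ltnP j.+1 (size l); last first.
    by apply: leq_trans; exact: count_size.
  rewrite leqNgt -le_ranked//= -yE -ltNge lt_neqAle nth_uniq ?size_sort//.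
  rewrite gtn_eqF//=; apply: (ranked_le j.+1 j.+2) => //.
rewrite numE -yE /ranked nth_uniq ?size_sort//; last by case: (k) k0 kl.
by case: (k) k0 => // m _; rewrite eqSS.
Qed.

Lemma ranked_map (V : R -> R) k l : {homo V : x y / x <= y} -> (0 < k)%N ->
  (k <= size l)%N -> ranked k (map V l) = V (ranked k l).
Proof.
move=> hV k0 kl; rewrite /ranked -(nth_map _ 0); last by rewrite size_sort; case: (k) k0 kl.
congr nth; apply: (sorted_eq geR_trans geR_anti).
- exact: sort_sorted.
- by apply: (homo_sorted (e := geR)) => //; [move=> x y; exact: hV].
- by rewrite perm_sort perm_sym; apply: perm_map; rewrite perm_sort.
Qed.

Lemma sum_ranked_sub k l : (0 < k)%N -> (k <= size l)%N ->
  \sum_(1 <= i < k.+1) (ranked i l - ranked k l) = excess (ranked k l) l.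
Proof.
move=> k0 kl; have pl : perm_eq (sort geR l) l by rewrite perm_sort.
rewrite -(excess_perm _ _ _ pl) /excess [RHS](big_nth 0) size_sort [RHS](@big_cat_nat _ _ _ k)//=.
rewrite [X in _ = _ + X](_ : _ = 0) ?addr0; last first.
  rewrite big_nat; apply: big1 => i /andP[ki il]; rewrite max_l// subr_le0.
  by apply: (ranked_le k i.+1) => //; exact: leqW.
rewrite big_add1 /= big_nat [RHS]big_nat; apply: eq_bigr => i /andP[_ ik].
by rewrite max_r// subr_ge0; apply: (ranked_le i.+1 k).
Qed.

End order_statistics.

(** * Independence of the k-th largest exponential and the excess over it *)

Section renyi.
Context {R : realType}.
Local Notation expo := (std_exponential R).
Implicit Types (B C : set R) (y : R).

Lemma measurable_ranked {d} {T : measurableType d} n k (v : T -> n.-tuple R) :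
  measurable_fun setT v -> measurable_fun setT (fun w => ranked k (v w)).
Proof.
(* Ranks 0 and 1 give the same value because of [k.-1], so the rank may be taken positive; beyond n
   the default 0 makes the function constant. *)
move=> mv; rewrite (_ : (fun _ => _) = fun w => ranked k.-1.+1 (v w))//.
have [kn|kn] := ltnP k.-1 n; last first.
  rewrite (_ : (fun _ => _) = cst 0)//.
  by apply/funext => w; rewrite /ranked nth_default// size_sort size_tuple.
apply: (measurability (@RGenCInfty.G R)) => [|/= _ [_] [r] -> <-].
  exact: RGenCInfty.measurableE.
rewrite setTI (_ : _ @^-1` _ = [set w | (k.-1.+1 <= num_ge (cst r w) (v w))%N]).
  exact: measurable_num_ge_ge.
by apply/seteqP; split => w /=; rewrite in_itv/= andbT le_ranked ?size_tuple.
Qed.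

Lemma measurable_uniq n : measurable [set t : n.-tuple R | uniq t].
Proof.
rewrite (_ : [set _ | _] = \bigcap_(i in [set: 'I_n]) \bigcap_(j in [set: 'I_n])
    [set t : n.-tuple R | (i == j) || (tnth t i != tnth t j)]).
  apply: fin_bigcap_measurable => // i _; apply: fin_bigcap_measurable => // j _.
  have [->|ij] := eqVneq i j; first by rewrite (_ : [set _ | _] = setT)//; apply/seteqP.
  rewrite (_ : [set _ | _] = (fun t : n.-tuple R => tnth t i == tnth t j) @^-1` [set false]).
    rewrite -[X in measurable X]setTI; apply: measurable_fun_eqr => //; exact: measurable_tnth.
  by apply/seteqP; split => t /=; [move/negbTE|move=> ->].
apply/seteqP; split => t /=.
  by move=> /tuple_uniqP ut i _ j _ /=; case: eqVneq => //= ij; rewrite (inj_eq ut).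
move=> h; apply/tuple_uniqP => i j tij; apply/eqP.
by have := h i I j I; rewrite /= tij eqxx orbF.
Qed.

(** Conditionally on the first coordinate, the others almost surely avoid it because the law has no
    atoms. *)
Lemma iid_uniq n : iid expo n [set t : n.-tuple R | uniq t] = 1%E.
Proof.
elim: n => [|n ih]; first by rewrite /= diracE mem_set.
rewrite iidS; last exact: measurable_uniq.
rewrite (eq_integral (cst 1%E)).
  rewrite integral_cst// mul1e; exact: probability_setT.
move=> x _; rewrite [RHS]/cst -[RHS]ih.
have mx : measurable (~` [set x : measurableTypeR R]).
  by apply: measurableC; exact: measurable_set1.
have mB : measurable [set t : n.-tuple R | forall i, (~` [set x]) (tnth t i)].
  by apply: (@measurable_rect _ (measurableTypeR R) n (fun=> ~` [set x])) => i; exact: mx.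
have B1 : iid expo n [set t : n.-tuple R | forall i, (~` [set x]) (tnth t i)] = 1%E.
  apply: (eq_trans (iid_rect expo n (fun=> ~` [set x]) (fun=> mx))).
  apply: big1 => i _; have := probability_setC expo (measurable_set1 x).
  by rewrite std_exponential_set1 sube0.
set B := (X in iid expo n X = _) in B1; set U := [set t : n.-tuple R | uniq t].
rewrite (_ : [set t | _] = U `\` ~` B).
  rewrite measureD; [|exact: measurable_uniq|exact: measurableC|]; last first.
    by rewrite -ge0_fin_numE// fin_num_measure//; exact: measurable_uniq.
  rewrite [X in (_ - X)%E](_ : _ = 0%E) ?sube0//.
  apply/eqP; rewrite -measure_le0 (le_trans (measureIr _ _ _))//; [exact: measurable_uniq|exact: measurableC|].
  have := probability_setC (iid expo n) mB; rewrite B1 subee// => h.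
  by rewrite le_eqVlt; apply/orP; left; apply/eqP; exact: h.
rewrite setDE setCK; apply/seteqP; split => t /=.
  move=> /andP[xt ut]; split => // i /= xi.
  by move: xt; rewrite -xi mem_tnth.
move=> [-> h]; rewrite andbT; apply/negP => /tnthP [i xi].
exact: (h i (esym xi)).
Qed.

(** Marks y as the k-th largest point. Expressing this through a count and an excess makes it
    invariant under permutations of [s], as Mecke's formula demands. *)
Let sel B k C y (s : seq R) : \bar R :=
  ((`[< B y /\ num_ge y s = k /\ C (excess y s) >] : bool)%:R : R)%:E.

Let sel_ge0 B k C y s : (0 <= sel B k C y s)%E.
Proof. by rewrite lee_fin. Qed.

Let sel_measurable B k C : measurable B -> measurable C -> seq_measurable (sel B k C).
Proof.
move=> mB mC n.
have mA : measurable [set p : R * n.-tuple R | B p.1 /\ num_ge p.1 p.2 = k /\ C (excess p.1 p.2)].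
  apply: measurableI; first by rewrite -[X in measurable X]setTI; exact: measurable_fst.
  by apply: measurableI; [exact: measurable_num_ge_eq|exact: measurable_excess_in].
apply/measurable_EFinP; rewrite (_ : (fun _ => _) = \1_[set p : R * n.-tuple R |
    B p.1 /\ num_ge p.1 p.2 = k /\ C (excess p.1 p.2)])//.
Qed.

Let sum_sel B k C n (t : n.-tuple R) : (0 < k)%N -> (k <= n)%N -> uniq t ->
  (\sum_(y <- t) sel B k C y t = (\1_[set t : n.-tuple R |
     B (ranked k t) /\ C (excess (ranked k t) t)] t)%:E)%E.
Proof.
move=> k0 kn ut; have sz : (k <= size t)%N by rewrite size_tuple.
rewrite (bigD1_seq (ranked k t))//=; last exact: ranked_in.
rewrite big_seq_cond big1 ?adde0; last first.
  move=> y /andP[yt yr]; rewrite /sel asboolF// => -[_ [/eqP]].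
  by rewrite num_ge_uniq// (negbTE yr).
rewrite /sel indicE; congr ((nat_of_bool _)%:R%:E).
apply/asboolP/idP => [[Br [_ Cr]]|]; first by apply/mem_set.
move=> /set_mem /= [Br Cr]; split => //; split => //; apply/eqP.
by rewrite num_ge_uniq ?ranked_in.
Qed.

(** Mecke's formula fixes the k-th largest point at y; given y, the excess of the k - 1 larger
    points is Gamma(k - 1) whatever y is, so the law of C factors out of the integral over y. *)
Let iid_ranked_aux B n k : (0 < k)%N -> (k <= n)%N -> measurable B -> (forall y, B y -> 0 <= y) ->
  exists J : \bar R, forall C, measurable C ->
  iid expo n [set t : n.-tuple R | B (ranked k t) /\ C (excess (ranked k t) t)] =
  (J * gamma_law k.-1 C)%E.
Proof.
case: n => [|n]; first by case: k.
move=> k0 kn mB B0.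
(* The probability that exactly k - 1 of the n remaining points exceed y. *)
pose c y := 'C(n, k.-1)%:R * expR (- y) ^+ k.-1 * (1 - expR (- y)) ^+ (n - k.-1).
exists (n.+1%:R%:E * \int[expo]_y (\1_B y * c y)%:E)%E => C mC.
have mA : measurable [set t : n.+1.-tuple R | B (ranked k t) /\ C (excess (ranked k t) t)].
  have mr := measurable_ranked n.+1 k id (@measurable_id _ _ _).
  have mE := measurable_excess_in (fun t : n.+1.-tuple R => ranked k t) id mr (@measurable_id _ _ _) C mC.
  have mB' : measurable [set t : n.+1.-tuple R | B (ranked k t)].
    by rewrite -[X in measurable X]setTI; exact: mr.
  exact: measurableI mB' mE.
rewrite -[X in iid expo n.+1 X]setIT -integral_indic//.
transitivity (\int[iid expo n.+1]_t (\sum_(y <- t) sel B k C y t))%E.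
  (* The sum selects the k-th largest point only when there are no ties, hence an almost sure
     equality. *)
  apply: ae_eq_integral => //.
  - exact/measurable_EFinP/measurable_indic.
  - exact: (measurable_sum_tuple (sel B k C) n.+1 (sel_measurable B k C mB mC)).
  - exists (~` [set t : n.+1.-tuple R | uniq t]); split.
    + exact: measurableC (measurable_uniq n.+1).
    + by have := probability_setC (iid expo n.+1) (measurable_uniq n.+1); rewrite iid_uniq subee.
    + by move=> t /= h ut; apply: h => _; rewrite sum_sel.
rewrite integral_sum_tuple; first last.
- by move=> y s s' ss'; rewrite /sel (num_ge_perm _ _ _ ss') (excess_perm _ _ _ ss').
- by move=> y s; exact: sel_ge0.
- exact: sel_measurable.
rewrite -muleA; congr (_ * _)%E.
have c0 y : (0 <= (\1_B y * c y)%:E)%E.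
  rewrite lee_fin indicE; have [/set_mem/B0 y0|_] := boolP (y \in B); last by rewrite mul0r.
  rewrite !mulr_ge0 ?exprn_ge0 ?expR_ge0// subr_ge0 -expR0 ler_expR oppr_le0//.
have mc : measurable_fun setT (fun y => (\1_B y * c y)%:E).
  apply/measurable_EFinP/measurable_funM; first exact: measurable_indic.
  have me : measurable_fun setT (fun y : R => expR (- y)).
    by apply: measurableT_comp => //; exact: measurableT_comp.
  apply: measurable_funM; last by apply: measurable_funX; exact: measurable_funB.
  by apply: measurable_funM => //; exact: measurable_funX.
rewrite -ge0_integralZr//.
apply: eq_integral => y _; rewrite indicE.
have [/set_mem By|By] := boolP (y \in B); last first.
  rewrite mul0r mul0e; apply: integral0_eq => t _; rewrite /sel asboolF//.
  by move=> -[/mem_set]; rewrite (negbTE By).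
rewrite mul1r -iid_num_ge_excess ?B0//.
have mD : measurable [set t : n.-tuple R | num_ge y t = k.-1 /\ C (excess y t)].
  apply: measurableI; first exact: (measurable_num_ge_eq (cst y) id).
  exact: (measurable_excess_in (cst y) id).
rewrite -[X in _ = iid expo n X]setIT -integral_indic//; apply: eq_integral => t _.
rewrite /sel indicE num_ge_cons excess_cons lexx subrr max_l// add0r add1n.
congr ((nat_of_bool _)%:R%:E); apply/asboolP/idP.
  move=> [_ [<- Ct]]; exact/mem_set.
by move=> /set_mem /= [-> Ct]; rewrite (prednK k0).
Qed.

(** The factor left unidentified in [iid_ranked_aux] is read off by taking C to be the whole
    line. *)
Lemma iid_ranked B C n k : (0 < k)%N -> (k <= n)%N -> measurable B ->
  (forall y, B y -> 0 <= y) -> measurable C ->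
  iid expo n [set t : n.-tuple R | B (ranked k t) /\ C (excess (ranked k t) t)] =
  (iid expo n [set t : n.-tuple R | B (ranked k t)] * gamma_law k.-1 C)%E.
Proof.
move=> k0 kn mB B0 mC; have [J hJ] := iid_ranked_aux B n k k0 kn mB B0.
rewrite hJ//; congr (_ * _)%E.
have := hJ setT measurableT; rewrite gamma_lawT mule1 => <-.
by congr (iid expo n _); apply/seteqP; split => t //= [].
Qed.

End renyi.

(** * From exponential bounds at dilated deviations to a logarithmic equivalence *)

Section rate_asymptotics.
Context {R : realType}.
Local Notation f := (@rate_fun R).

(** By the tangent inequality f changes by O(d x^2), and x^2 is O(f(x)) on [- M, 1 - rho]; hence the
    error is relative, uniformly down to x = 0. *)
Lemma rate_fun_dilation_le (x d M rho : R) : 0 < rho <= 1 -> - M <= x <= 1 - rho ->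
  0 <= d <= rho / 4 ->
  f ((1 + 2 * d) * x) <= (1 + 16 * (2 + M) / rho * d) * f x /\
  (1 - 2 * (2 + M) / rho * d) * f x <= f ((1 - d) * x).
Proof.
move=> /andP[r0 r1] /andP[xM xr] /andP[d0 dr].
have x1 : x < 1 by lra.
have M0 : 0 < 2 + M by lra.
have fx : x ^+ 2 <= 2 * (2 + M) * f x.
  have := rate_fun_ge_sqr x x1; rewrite ler_pdivrMr; last by lra.
  have := rate_fun_ge0 x x1; nra.
have f0 := rate_fun_ge0 x x1.
have x2 := sqr_ge0 x.
have r8 : 0 <= 8 / rho by rewrite divr_ge0// ltW.
split.
  set y := (1 + 2 * d) * x.
  have y1 : rho / 2 <= 1 - y by rewrite /y; have [x0|x0] := leP 0 x; nra.
  have y1' : y < 1 by lra.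
  have h := rate_fun_sub_le x y x1 y1'.
  have : (y - x) * y / (1 - y) <= 8 / rho * d * x ^+ 2.
    rewrite ler_pdivrMr; last by lra.
    have -> : (y - x) * y = 2 * d * (1 + 2 * d) * x ^+ 2 by rewrite /y; ring.
    apply: (@le_trans _ _ (8 / rho * d * x ^+ 2 * (rho / 2))); last first.
      by rewrite ler_wpM2l// mulr_ge0// mulr_ge0.
    have -> : 8 / rho * d * x ^+ 2 * (rho / 2) = 4 * d * x ^+ 2 by field; lra.
    by rewrite ler_wpM2r//; nra.
  have : 8 / rho * d * x ^+ 2 <= 8 / rho * d * (2 * (2 + M) * f x).
    by rewrite ler_wpM2l// mulr_ge0// mulr_ge0.
  have -> : 8 / rho * d * (2 * (2 + M) * f x) = 16 * (2 + M) / rho * d * f x.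
    by field; lra.
  lra.
set y := (1 - d) * x.
have y1 : y < 1 by rewrite /y; have [x0|x0] := leP 0 x; nra.
have h := rate_fun_sub_le y x y1 x1.
have : (x - y) * x / (1 - x) <= d * x ^+ 2 / rho.
  have -> : (x - y) * x = d * x ^+ 2 by rewrite /y; ring.
  apply: ler_wpM2l; first by rewrite mulr_ge0.
  by rewrite lef_pV2 ?posrE; lra.
have : d * x ^+ 2 / rho <= d * (2 * (2 + M) * f x) / rho.
  by rewrite ler_wpM2r ?invr_ge0 ?(ltW r0)// ler_wpM2l.
have -> : d * (2 * (2 + M) * f x) / rho = 2 * (2 + M) / rho * d * f x by field; lra.
lra.
Qed.

(** With W = |x| sqrt k, the quadratic bound gives W^2 = O(k f(x)). As W tends to infinity,
    constants and terms linear in W are negligible, and the dilations cost a relative error that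
    vanishes with d. *)
Lemma rate_asymp (x p : nat -> R) (k : nat -> nat) (M rho C0 : R) :
  0 < rho <= 1 -> 0 <= M -> 0 < C0 ->
  (\forall n \near \oo, - M <= x n <= 1 - rho) ->
  (forall A : R, \forall n \near \oo, A <= `|x n| * Num.sqrt (k n)%:R) ->
  (forall d : R, 0 < d <= rho / 4 -> exists2 c, 0 < c & \forall n \near \oo,
     c * expR (- ((k n)%:R * f ((1 + 2 * d) * x n)) - C0 * (`|x n| * Num.sqrt (k n)%:R)) <= p n /\
     p n <= C0 * expR (- ((k n)%:R * f ((1 - d) * x n)))) ->
  - ln (p n) / ((k n)%:R * f (x n)) @[n --> \oo] --> (1 : R).
Proof.
move=> hr M0 C00 hx hW hp; have /andP[r0 r1] := hr.
pose K := 2 * (2 + M); have K0 : 0 < K by rewrite /K; lra.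
apply/cvgrPdist_le => e e0.
pose L := 16 * (2 + M) / rho; have L0 : 0 < L by rewrite /L divr_gt0//; lra.
(* The error e is split in three: one third pays for the dilation through [Ld], another for all
   constants and the term linear in W through [SW]. *)
pose d := Num.min (rho / 4) (e / (3 * L)).
have eL : 0 < e / (3 * L) by rewrite divr_gt0//; lra.
have d0 : 0 < d by rewrite /d lt_min eL andbT; lra.
have dr : d <= rho / 4 by rewrite /d ge_min lexx.
have Ld : L * d <= e / 3.
  apply: (@le_trans _ _ (L * (e / (3 * L)))).
    by rewrite ler_wpM2l ?(ltW L0)// /d ge_min lexx orbT.
  by rewrite (_ : L * (e / (3 * L)) = e / 3)//; field; lra.
have [c c0 hpd] := hp d (introT andP (conj d0 dr)).
near=> n.
have hxn : - M <= x n <= 1 - rho by near: n.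
have [hp1 hp2] : c * expR (- ((k n)%:R * f ((1 + 2 * d) * x n)) - C0 * (`|x n| * Num.sqrt (k n)%:R)) <= p n /\
     p n <= C0 * expR (- ((k n)%:R * f ((1 - d) * x n))) by near: n.
have W1 : 1 <= `|x n| * Num.sqrt (k n)%:R by near: n; exact: hW.
have W2 : 3 * K / e * (C0 + `|ln c| + `|ln C0|) <= `|x n| * Num.sqrt (k n)%:R.
  by near: n; exact: hW.
set W := `|x n| * Num.sqrt (k n)%:R in hp1 W1 W2.
(* The lower bound keeps [ln] away from its default value at 0. *)
have p0 : 0 < p n by apply: lt_le_trans hp1; rewrite mulr_gt0// expR_gt0.
have x1 : x n < 1 by case/andP: hxn => _ /le_lt_trans -> //; rewrite ltrBlDr ltrDl.
have [fu fl] := rate_fun_dilation_le (x n) d M rho hr hxn (introT andP (conj (ltW d0) dr)).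
set F := (k n)%:R * f (x n).
have kn0 : 0 <= (k n)%:R :> R by [].
have WW : W ^+ 2 <= K * F.
  have -> : W ^+ 2 = (k n)%:R * x n ^+ 2.
    by rewrite /W exprMn sqr_sqrtr// real_normK ?num_real// mulrC.
  rewrite /F [leRHS]mulrCA ler_wpM2l//.
  have := rate_fun_ge_sqr (x n) x1; rewrite ler_pdivrMr; last by lra.
  have := rate_fun_ge0 (x n) x1; rewrite /K; nra.
have F0 : 0 < F.
  by rewrite -(pmulr_rgt0 _ K0) (lt_le_trans _ WW)// exprn_gt0// (lt_le_trans ltr01 W1).
set S := C0 + `|ln c| + `|ln C0| in W2.
have S0 : 0 <= S by rewrite /S !addr_ge0// ltW.
have SW : S * W <= e / 3 * F.
  have h1 : 3 * K * S <= W * e by rewrite -ler_pdivrMr// mulrAC.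
  have h2 : 3 * K * S * W <= e * (K * F).
    apply: (@le_trans _ _ (e * W ^+ 2)); last by rewrite ler_wpM2l// ltW.
    rewrite expr2 [leRHS]mulrA (mulrC e).
    by apply: (ler_wpM2r (x := W)) => //; exact: le_trans ler01 W1.
  rewrite -(ler_pM2l K0); lra.
have SS : S <= S * W by rewrite ler_peMr.
have lnp1 : ln c - (k n)%:R * f ((1 + 2 * d) * x n) - C0 * W <= ln (p n).
  move: hp1; rewrite -ler_ln ?posrE ?mulr_gt0 ?expR_gt0// lnM ?posrE ?expR_gt0// expRK.
  lra.
have lnp2 : ln (p n) <= ln C0 - (k n)%:R * f ((1 - d) * x n).
  by move: hp2; rewrite -ler_ln ?posrE ?mulr_gt0 ?expR_gt0// lnM ?posrE ?expR_gt0// expRK.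
have lc := ler_norm (- ln c); rewrite normrN in lc.
have lC := ler_norm (ln C0).
have nc := normr_ge0 (ln c); have nC := normr_ge0 (ln C0).
have kfu : (k n)%:R * f ((1 + 2 * d) * x n) <= (1 + L * d) * F.
  by rewrite /F mulrCA ler_wpM2l.
have kfl : (1 - L / 8 * d) * F <= (k n)%:R * f ((1 - d) * x n).
  rewrite /F mulrCA ler_wpM2l// (le_trans _ fl)//.
  by rewrite (_ : L / 8 = 2 * (2 + M) / rho)// /L; field; rewrite gt_eqF.
have LdF : L * d * F <= e / 3 * F by rewrite ler_wpM2r// ltW.
have LdF0 : 0 <= L * d * F by apply: mulr_ge0; [apply: mulr_ge0|]; apply: ltW.
have W0 : 0 <= W := le_trans ler01 W1.
have C0W : C0 * W <= S * W by rewrite ler_wpM2r// /S -addrA lerDl addr_ge0.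
clear hxn hp1 hp2 W2 x1 fu fl WW kn0.
rewrite ler_distlC; apply/andP; split.
  have lCS : `|ln C0| <= S by rewrite /S; lra.
  rewrite ler_pdivlMr//; lra.
rewrite ler_pdivrMr//.
have hcW : `|ln c| * W + C0 * W <= S * W by rewrite /S; nra.
have hc : `|ln c| <= `|ln c| * W by rewrite ler_peMr.
lra.
Unshelve. all: by end_near. Qed.

End rate_asymptotics.

(** * The sample as an image of independent exponentials *)

Lemma measurable_map_tuple {R : realType} (V : R -> R) n : measurable_fun setT V ->
  measurable_fun setT (fun t : n.-tuple R => map_tuple V t : n.-tuple R).
Proof.
move=> mV; apply/measurable_fun_tnthP => i.
rewrite (_ : _ \o _ = V \o (fun t : n.-tuple (measurableTypeR R) => tnth t i)); last first.
  by apply/funext => t /=; rewrite tnth_map.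
by apply: measurableT_comp; last exact: measurable_tnth.
Qed.

Section transfer.
Context {R : realType} {d : measure_display} {T : measurableType d}
  (P : probability T R) (X : nat -> {RV P >-> R}) (V : R -> R).
Local Notation expo := (std_exponential R).

Hypothesis X_indep : mutually_independent X.
Hypothesis mV : measurable_fun setT V.
Hypothesis X_law : forall i A, measurable A -> distribution P (X i) A = expo (V @^-1` A).

Definition sample n (w : T) : n.-tuple (measurableTypeR R) := [tuple X i w | i < n].

Lemma measurable_sample n : measurable_fun setT (sample n).
Proof.
apply/measurable_fun_tnthP => i.
rewrite (_ : _ \o _ = X i); last by apply/funext => w /=; rewrite tnth_mktuple.
exact: (measurable_funPT (X i)).
Qed.

Definition map_sample n (t : n.-tuple (measurableTypeR R)) : n.-tuple (measurableTypeR R) :=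
  map_tuple V t.

Lemma measurable_map_sample n : measurable_fun setT (map_sample n).
Proof. exact: measurable_map_tuple. Qed.

HB.instance Definition _ n := isMeasurableFun.Build _ _ _ _ (sample n) (measurable_sample n).
HB.instance Definition _ n := isMeasurableFun.Build _ _ _ _ (map_sample n) (measurable_map_sample n).

(** Independence and the marginal laws determine the joint law on rectangles, hence everywhere. *)
Lemma sample_law n (A : set (n.-tuple R)) : measurable A ->
  P (sample n @^-1` A) = iid expo n [set t : n.-tuple R | A (map_tuple V t)].
Proof.
move=> mA.
suff : distribution P (sample n) A = distribution (iid expo n) (map_sample n) A by [].
apply: (measure_tuple_unique n (distribution P (sample n))
  (distribution (iid expo n) (map_sample n)) _ A mA) => B mB.
rewrite /distribution /pushforward.
(* Independence is stated for families indexed by all naturals, so the n sides are padded with the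
   whole line. *)
pose B' j := if insub j is Some i then B i else setT.
have mB' j : measurable (B' j) by rewrite /B'; case: insub.
pose J := [fset x in iota 0 n]%fset.
have JE : perm_eq J (iota 0 n).
  apply: uniq_perm; [exact: fset_uniq|exact: iota_uniq|].
  by move=> x; rewrite !inE.
have hJ i : (i \in J) = (i < n)%N by rewrite (perm_mem JE) mem_iota.
have B'E (i : 'I_n) : B' i = B i by rewrite /B' valK.
transitivity (P (\bigcap_(i in [set` J]) (X i @^-1` B' i))).
  congr (P _); apply/seteqP; split => w /=.
    move=> h j /=; rewrite hJ => jn; rewrite -[j]/(nat_of_ord (Ordinal jn)) B'E.
    by have := h (Ordinal jn); rewrite tnth_mktuple.
  move=> h i; rewrite tnth_mktuple -B'E; apply: h => /=.
  by rewrite hJ.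
rewrite X_indep// (perm_big _ JE)/= -[n in iota 0 n]subn0 -/(index_iota 0 n) big_mkord.
have mVB i : measurable (V @^-1` B i).
  by have := mV measurableT (B i) (mB i); rewrite setTI; exact.
transitivity (\prod_(i < n) expo (V @^-1` B i))%E.
  by apply: eq_bigr => i _; rewrite B'E; exact: (X_law i (B i) (mB i)).
apply: (eq_trans (esym (iid_rect expo n (fun i => V @^-1` B i) mVB))).
rewrite /distribution /pushforward; congr (iid expo n _).
by apply/seteqP; split => t /= h i; have := h i; rewrite tnth_map.
Qed.

End transfer.

(** * Comparing the Hill statistic with the normalised excess *)

Section hill_statistic.
Context {R : realType}.
Implicit Types (l : seq R) (k n : nat).

Definition hill_seq k l : R :=
  k%:R^-1 * \sum_(1 <= i < k.+1) ln (ranked i l / ranked k l).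

Lemma hillE (x : nat -> R) k n : hill x k n = hill_seq k [tuple x i | i < n].
Proof.
rewrite /hill /hill_seq; congr (_ * _); apply: eq_bigr => i _.
have -> : [tuple x i | i < n] = [seq x j | j <- iota 0 n] :> seq R.
  by rewrite /= -val_enum_ord -map_comp.
by [].
Qed.

(* On (0, +oo) this is U o exp; the value 0 elsewhere makes it monotone on R. *)
Definition log_tail (U : R -> R) (s : R) : R := if 0 < s then U (expR s) else 0.

Lemma log_tail_nondecreasing g U : RV' g U -> {homo log_tail U : x y / x <= y}.
Proof.
move=> [U0 Und _ _] x y xy; rewrite /log_tail.
have e1 z : 0 < z -> 1 < expR z by move=> z0; rewrite expR_gt1.
case: ifPn => x0; case: ifPn => y0 //.
- by apply: Und; rewrite ?e1// ler_expR.
- by move: y0; rewrite (lt_le_trans x0 xy).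
- by apply/ltW/U0/e1.
Qed.

(** The logarithm of the Potter bounds, term by term. The additive errors come from ln (1 - e) >= -
    2 e, valid for e <= 1 / 2, and ln (1 + e) <= e. *)
Lemma hill_potter_bounds a U (e L : R) k l : 0 < a -> RV' a^-1 U -> e <= 2^-1 ->
  potter_bounds a U (expR L) e -> 0 < L -> (0 < k)%N -> (k <= size l)%N ->
  L <= ranked k l ->
  (1 - e) * (excess (ranked k l) l / k%:R) - 2 * a * e
    <= a * hill_seq k (map (log_tail U) l)
    <= (1 + e) * (excess (ranked k l) l / k%:R) + a * e.
Proof.
move=> a0 hU e2 [e0 hp] L0 k0 kl Lk.
have [U0 _ _ _] := hU.
have hV := log_tail_nondecreasing _ _ hU.
have kR : 0 < k%:R :> R by rewrite ltr0n.
have ln1e : - (2 * e) <= ln (1 - e).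
  have := ln_le_subr1 (1 - e)^-1; rewrite invr_gt0 subr_gt0 lnV ?posrE ?subr_gt0; try lra.
  move=> /(_ ltac:(lra)) h.
  have : (1 - e)^-1 - 1 <= 2 * e.
    rewrite -[X in _ - X](@mulfV _ (1 - e)); last by lra.
    rewrite -[X in X - _]mul1r -mulrBl ler_pdivrMr; nra.
  lra.
have ln1De : ln (1 + e) <= e by have := ln_le_subr1 (1 + e); lra.
have term i : (0 < i)%N -> (i <= k)%N ->
   (1 - e) * (ranked i l - ranked k l) - 2 * a * e
    <= a * ln (ranked i (map (log_tail U) l) / ranked k (map (log_tail U) l))
    <= (1 + e) * (ranked i l - ranked k l) + a * e.
  move=> i0 ik; have il : (i <= size l)%N by exact: leq_trans kl.
  rewrite !ranked_map//.
  have Eki : ranked k l <= ranked i l by exact: ranked_le.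
  have Ek0 : 0 < ranked k l by lra.
  have Ei0 : 0 < ranked i l by lra.
  rewrite /log_tail Ek0 Ei0.
  set x := expR (ranked i l); set y := expR (ranked k l).
  have Uy : 0 < U y by apply: U0; rewrite /y expR_gt1.
  have Ux : 0 < U x by apply: U0; rewrite /x expR_gt1.
  have [h1 h2] : (1 - e) * (x / y) `^ ((1 - e) / a) <= U x / U y /\
    U x / U y <= (1 + e) * (x / y) `^ ((1 + e) / a).
    by apply: hp; rewrite /x /y ler_expR.
  have xy : x / y = expR (ranked i l - ranked k l) by rewrite /x /y expRD expRN.
  have powE c : (x / y) `^ c = expR (c * (ranked i l - ranked k l)).
    by rewrite xy /powR gt_eqF ?expR_gt0// expRK.
  rewrite !powE in h1 h2.
  have r0 : 0 < U x / U y by rewrite divr_gt0.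
  have g1 : ln (1 - e) + (1 - e) / a * (ranked i l - ranked k l) <= ln (U x / U y).
    rewrite -[X in _ + X]expRK -lnM ?posrE ?expR_gt0//; last by lra.
    by rewrite ler_ln ?posrE// mulr_gt0 ?expR_gt0//; lra.
  have g2 : ln (U x / U y) <= ln (1 + e) + (1 + e) / a * (ranked i l - ranked k l).
    rewrite -[X in _ + X]expRK -lnM ?posrE ?expR_gt0//; last by lra.
    by rewrite ler_ln ?posrE// mulr_gt0 ?expR_gt0//; lra.
  apply/andP; split.
    apply: (@le_trans _ _ (a * (ln (1 - e) + (1 - e) / a * (ranked i l - ranked k l)))); last first.
      by rewrite ler_pM2l.
    have -> : a * (ln (1 - e) + (1 - e) / a * (ranked i l - ranked k l)) =
        a * ln (1 - e) + (1 - e) * (ranked i l - ranked k l) by field; lra.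
    nra.
  apply: (@le_trans _ _ (a * (ln (1 + e) + (1 + e) / a * (ranked i l - ranked k l)))).
    by rewrite ler_pM2l.
  have -> : a * (ln (1 + e) + (1 + e) / a * (ranked i l - ranked k l)) =
      a * ln (1 + e) + (1 + e) * (ranked i l - ranked k l) by field; lra.
  nra.
have sumE c b : \sum_(1 <= i < k.+1) (c * (ranked i l - ranked k l) + b) =
    k%:R * (c * (excess (ranked k l) l / k%:R) + b).
  rewrite big_split /= -mulr_sumr sum_ranked_sub// sumr_const_nat subSS subn0 -mulr_natl.
  by field; lra.
have hillM : k%:R * (a * hill_seq k (map (log_tail U) l)) = \sum_(1 <= i < k.+1)
    (a * ln (ranked i (map (log_tail U) l) / ranked k (map (log_tail U) l))).
  by rewrite -mulr_sumr /hill_seq; field; lra.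
apply/andP; split; rewrite -(ler_pM2l kR) hillM -sumE; rewrite big_nat [leRHS]big_nat;
  apply: ler_sum => i /andP[i0 ik]; by have /andP[] := term i i0 ik.
Qed.

End hill_statistic.

(** * Nonasymptotic bounds for an event sandwiched by the excess *)

Section tail_bounds.
Context {R : realType}.
Local Notation expo := (std_exponential R).
Local Notation f := (@rate_fun R).
Implicit Types (L q x d M rho : R) (C : set R).

Lemma iid_ranked_lt n k L q : (0 < k)%N -> (k <= n)%N -> 0 <= L -> 1 <= q ->
  n%:R * expR (- L) = q * k%:R ->
  (iid expo n [set t : n.-tuple R | (ranked k t < L)%R] <=
   (expR (- (k%:R * f (1 - q))))%:E)%E.
Proof.
move=> k0 kn L0 q1 nL; rewrite (_ : [set _ | _] = [set t : n.-tuple R | (num_ge L t < k)%N]).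
  exact: num_ge_chernoff.
by apply/seteqP; split => t /=; rewrite ltNge le_ranked ?size_tuple// ltnNge.
Qed.

Let measurable_ranked_ge n k L : measurable [set t : n.-tuple R | L <= ranked k t].
Proof.
have := @measurable_ranked R _ _ n k id (@measurable_id _ _ setT).
move=> /(_ measurableT `[L, +oo[%classic (measurable_itv _)); rewrite setTI.
by rewrite (_ : _ @^-1` _ = [set t : n.-tuple R | L <= ranked k t])//; apply/seteqP; split => t /=; rewrite in_itv/= andbT.
Qed.

Let measurable_ranked_excess n k L C : measurable C ->
  measurable [set t : n.-tuple R | (L <= ranked k t)%R /\ C (excess (ranked k t) t)].
Proof.
move=> mC; exact: (measurableI _ _ (measurable_ranked_ge n k L)
  (@measurable_excess_in R _ _ n (fun t : n.-tuple R => ranked k t) id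
    (measurable_ranked n k id (@measurable_id _ _ _)) (@measurable_id _ _ _) C mC)).
Qed.

Let ranked_geC n k L : [set t : n.-tuple R | ranked k t < L] =
  ~` [set t : n.-tuple R | L <= ranked k t].
Proof. by apply/seteqP; split => t /=; rewrite ltNge => /negP. Qed.

(** Potter bounds hold only above the level L, so the failure of the level is added to the Gamma
    probability. *)
Lemma iid_event_le n k L q C (Ev : set (n.-tuple R)) :
  (0 < k)%N -> (k <= n)%N -> 0 <= L -> 1 <= q -> n%:R * expR (- L) = q * k%:R ->
  measurable C -> measurable Ev ->
  (forall t : n.-tuple R, L <= ranked k t -> Ev t -> C (excess (ranked k t) t)) ->
  (iid expo n Ev <= (expR (- (k%:R * f (1 - q))))%:E + gamma_law k.-1 C)%E.
Proof.
move=> k0 kn L0 q1 nL mC mEv hEv.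
pose A1 := [set t : n.-tuple R | (ranked k t < L)%R].
have mA1 : measurable A1 by rewrite /A1 ranked_geC; exact: measurableC (measurable_ranked_ge n k L).
pose A2 := [set t : n.-tuple R | (L <= ranked k t)%R /\ C (excess (ranked k t) t)].
have mA2 : measurable A2 by exact: measurable_ranked_excess.
have h1 : (iid expo n Ev <= iid expo n (A1 `|` A2))%E.
  apply: le_measure; rewrite ?inE//; first exact: measurableU.
  move=> t Et; have [h|h] := ltP (ranked k t) L; [by left|right].
  by split => //; exact: hEv.
apply: (le_trans h1); apply: (le_trans (measureU2 (iid expo n) mA1 mA2)).
apply: leeD; first exact: iid_ranked_lt.
have mL : measurable [set y : R | L <= y] by rewrite -set_itvcy.
have hr : iid expo n A2 = (iid expo n [set t : n.-tuple R | (L <= ranked k t)%R] * gamma_law k.-1 C)%E.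
  exact: (iid_ranked [set y : R | L <= y] C n k k0 kn mL (fun y => le_trans L0) mC).
have h2 : (iid expo n A2 <= gamma_law k.-1 C)%E.
  rewrite hr -[leRHS]mul1e; apply: lee_wpmul2r => //; apply: probability_le1.
  exact: measurable_ranked_ge.
exact: h2.
Qed.

(** Independence of level and excess turns the failure of the level into a factor at least 1 / 2
    rather than a subtracted term, which could exceed the small Gamma probability. *)
Lemma iid_event_ge n k L q C (Ev : set (n.-tuple R)) :
  (0 < k)%N -> (k <= n)%N -> 0 <= L -> 1 <= q -> n%:R * expR (- L) = q * k%:R ->
  expR (- (k%:R * f (1 - q))) <= 2^-1 ->
  measurable C -> measurable Ev ->
  (forall t : n.-tuple R, L <= ranked k t -> C (excess (ranked k t) t) -> Ev t) ->
  ((2^-1)%:E * gamma_law k.-1 C <= iid expo n Ev)%E.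
Proof.
move=> k0 kn L0 q1 nL half mC mEv hEv.
pose A2 := [set t : n.-tuple R | (L <= ranked k t)%R /\ C (excess (ranked k t) t)].
have mA2 : measurable A2 by exact: measurable_ranked_excess.
apply: (@le_trans _ _ (iid expo n A2)); last first.
  by apply: le_measure; rewrite ?inE// => t [? ?]; exact: hEv.
have mL : measurable [set y : R | L <= y] by rewrite -set_itvcy.
have hr : iid expo n A2 = (iid expo n [set t : n.-tuple R | (L <= ranked k t)%R] * gamma_law k.-1 C)%E.
  exact: (iid_ranked [set y : R | L <= y] C n k k0 kn mL (fun y => le_trans L0) mC).
rewrite hr.
rewrite lee_wpmul2r//.
have mB := measurable_ranked_ge n k L.
have := iid_ranked_lt n k L q k0 kn L0 q1 nL.
rewrite ranked_geC probability_setC// => h.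
have fin : iid expo n [set t : n.-tuple R | (L <= ranked k t)%R] \is a fin_num.
  by rewrite fin_num_measure.
move: h; rewrite -(fineK fin) -EFinB !lee_fin; lra.
Qed.

(** Negative x means a large excess and positive x a small one. [Ev] implies that the excess
    deviates at least as at (1 - d) x, and is implied by a window around the value at (1 + 2 d)
    x. *)
Lemma tail_bounds n k L q x d M rho (Ev : set (n.-tuple R)) :
  (256 <= k)%N -> (k <= n)%N -> 0 < L -> 1 <= q -> n%:R * expR (- L) = q * k%:R ->
  0 < rho <= 1 -> 0 <= M -> - M <= x <= 1 - rho -> 0 < d <= rho / 4 ->
  f x <= f (1 - q) -> expR (- (k%:R * f (1 - q))) <= 2^-1 ->
  measurable Ev ->
  (forall t : n.-tuple R, L <= ranked k t -> Ev t ->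
     0 <= - x * (excess (ranked k t) t - k%:R * (1 - (1 - d) * x))) ->
  (forall t : n.-tuple R, L <= ranked k t ->
     `|excess (ranked k t) t - k%:R * (1 - (1 + 2 * d) * x)|
       <= 8 * Num.sqrt k%:R * (1 - (1 + 2 * d) * x) -> Ev t) ->
  (4 * (1 + 2 * M))^-1 *
     expR (- (k%:R * f ((1 + 2 * d) * x)) - 16 * (`|x| * Num.sqrt k%:R))
    <= fine (iid expo n Ev) <= (1 + rho^-1) * expR (- (k%:R * f ((1 - d) * x))).
Proof.
move=> k256 kn L0 q1 nL /andP[r0 r1] M0 /andP[xM xr] /andP[d0 dr] fxq half mEv hu hl.
have k0 : (0 < k)%N by exact: leq_trans k256.
have Evfin : iid expo n Ev \is a fin_num by rewrite fin_num_measure.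
pose s1 := 1 - (1 - d) * x; pose s2 := 1 - (1 + 2 * d) * x.
have s1r : rho <= s1 by rewrite /s1; have [?|?] := leP 0 x; nra.
have s2r : rho / 2 <= s2 by rewrite /s2; have [?|?] := leP 0 x; nra.
have s2M : s2 <= 1 + 2 * M by rewrite /s2; have [?|?] := leP 0 x; nra.
have s10 : 0 < s1 by lra.
have s20 : 0 < s2 by lra.
apply/andP; split.
  pose C := [set z : R | `|z - k%:R * s2| <= 8 * Num.sqrt k%:R * s2].
  have mC : measurable C.
    rewrite -[X in measurable X]setTI; apply: measurable_fun_le => //.
    by apply: measurableT_comp => //; exact: measurable_funB.
  have h1 := iid_event_ge n k L q C Ev k0 kn (ltW L0) q1 nL half mC mEv hl.
  have h2 := gamma_law_ge k.-1 s2 k%:R (8 * Num.sqrt k%:R) C s20 mC (fun z hz => hz).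
  have h3 := gamma_law_concentration (R := R) k k256.
  set A := s2 ^+ k.-1 * _ in h2.
  have A0 : 0 <= A by rewrite /A mulr_ge0 ?expR_ge0 ?exprn_ge0 ?ltW.
  have h4 : ((2^-1 * (A * 2^-1))%:E <= iid expo n Ev)%E.
    apply: le_trans h1; rewrite EFinM; apply: lee_wpmul2l.
      by rewrite lee_fin invr_ge0.
    by apply: le_trans h2; rewrite EFinM; apply: lee_wpmul2l; rewrite ?lee_fin.
  move: h4; rewrite -[X in (_ <= X)%E](fineK Evfin) lee_fin; apply: le_trans.
  have AE : A = s2^-1 * expR (- (k%:R * f ((1 + 2 * d) * x)) - (1 + 2 * d) * `|x| * (8 * Num.sqrt k%:R)).
    rewrite /A expRD mulrA chernoff_rateE// [in RHS]expRD [RHS]mulrA.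
    congr (_ * expR (- (_ * f _)) * expR (- (_ * _))); first by rewrite /s2; ring.
    rewrite (_ : s2 - 1 = - ((1 + 2 * d) * x)); last by rewrite /s2; ring.
    by rewrite normrN normrM (ger0_norm (x := 1 + 2 * d)); last by lra.
  (* The two halves come from the level and from concentration, and 1 / s2 is at least 1 / (1 + 2
     M). *)
  rewrite AE (_ : 2^-1 * (_ * _ * 2^-1) = (4 * s2)^-1 * expR (- (k%:R * f ((1 + 2 * d) * x)) - (1 + 2 * d) * `|x| * (8 * Num.sqrt k%:R))); last first.
    by field; rewrite gt_eqF.
  clear hu hl h1 h2 h3 AE nL fxq half.
  have M1 : 0 < 1 + 2 * M := lt_le_trans s20 s2M.
  apply: ler_pM; rewrite ?expR_ge0 ?invr_ge0 ?mulr_ge0 ?(ltW M1)//.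
    rewrite lef_pV2 ?posrE ?mulr_gt0//.
    by rewrite ler_pM2l.
  rewrite ler_expR lerD2l lerN2.
  rewrite (_ : (1 + 2 * d) * `|x| * (8 * Num.sqrt k%:R) = (8 * (1 + 2 * d)) * (`|x| * Num.sqrt k%:R)); last by ring.
  by rewrite ler_wpM2r ?mulr_ge0 ?sqrtr_ge0//; lra.
pose C := [set z : R | 0 <= (s1 - 1) * (z - k%:R * s1)].
have mC : measurable C.
  rewrite -[X in measurable X]setTI; apply: measurable_fun_le => //.
  by apply: measurable_funM => //; exact: measurable_funB.
have h1 : (iid expo n Ev <= (expR (- (k%:R * f (1 - q))))%:E + gamma_law k.-1 C)%E.
  apply: (iid_event_le n k L q C Ev k0 kn (ltW L0) q1 nL mC mEv) => t Lt Et.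
  rewrite /C /= (_ : s1 - 1 = (1 - d) * - x); last by rewrite /s1; ring.
  by rewrite -mulrA mulr_ge0 ?hu//; lra.
have h2 := gamma_law_le k.-1 s1 k%:R C s10 mC (fun z hz => hz).
have h3 : (iid expo n Ev <= (expR (- (k%:R * f (1 - q))) + s1 ^+ k.-1 * expR (- (s1 - 1) * k%:R))%:E)%E.
  by apply: (le_trans h1); rewrite EFinD leeD2l.
move: h3; rewrite -[X in (X <= _)%E](fineK Evfin) lee_fin chernoff_rateE//.
rewrite (_ : 1 - s1 = (1 - d) * x); last by rewrite /s1; ring.
(* The summand 1 absorbs the failure of the level, as f((1 - d) x) <= f(x) <= f(1 - q); the other
   one bounds the prefactor 1 / s1 by 1 / rho. *)
move=> h; apply: (le_trans h); rewrite [leRHS]mulrDl mul1r; apply: lerD.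
  rewrite ler_expR lerN2 ler_wpM2l//; apply: le_trans fxq.
  clear hu hl h1 h2 h nL half.
  have x1 : x < 1 by lra.
  have y1 : (1 - d) * x < 1 by move: s10; rewrite /s1; lra.
  have := rate_fun_sub_le x ((1 - d) * x) x1 y1.
  rewrite (_ : ((1 - d) * x - x) * ((1 - d) * x) / (1 - (1 - d) * x) =
    - (d * (1 - d) * x ^+ 2 / (1 - (1 - d) * x))); last by rewrite -/s1; field; rewrite gt_eqF.
  have : 0 <= d * (1 - d) * x ^+ 2 / (1 - (1 - d) * x).
    apply: divr_ge0; last by move: s10; rewrite /s1; exact: ltW.
    by apply: mulr_ge0; [apply: mulr_ge0; lra|exact: sqr_ge0].
  lra.
by rewrite ler_wpM2r ?expR_ge0// lef_pV2 ?posrE.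
Qed.

End tail_bounds.

(** * Choice of the level and of the Potter error *)

Section levels.
Context {R : realType} (alpha : R) (U : R -> R) (k : nat -> nat) (theta : nat -> R) (eta M : R).
Local Notation f := (@rate_fun R).
Hypotheses (alpha_gt0 : 0 < alpha) (U_RV : RV' alpha^-1 U)
  (k_intermediate : intermediate R k) (theta_gt0 : forall j : nat, 0 < theta j)
  (theta_le : \forall n \near \oo, theta (k n) <= M) (eta_gt1 : 1 < eta)
  (theta_large : much_larger (fun n : nat => theta (k n))
     (fun n : nat => potter_rate alpha U (n%:R / (eta * (k n)%:R)) + (k n)%:R `^ (- 2^-1))).

Lemma intermediate_ge N : \forall n \near \oo, (N <= k n)%N.
Proof. by case: k_intermediate => /cvgnyPge /(_ N). Qed.

Lemma intermediate_ratio (A : R) : \forall n \near \oo, A <= n%:R / (k n)%:R.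
Proof.
have [_ kn0] := k_intermediate.
pose B := Num.max A 1; have B0 : 0 < B by rewrite /B lt_max ltr01 orbT.
have Bi : 0 < B^-1 by rewrite invr_gt0.
have k1 := intermediate_ge 1.
near=> n.
have h : `|(k n)%:R / n%:R : R| < B^-1.
  by near: n; exact: (cvgr0_norm_lt _ kn0 _ Bi).
have kn1 : 0 < (k n)%:R :> R by rewrite ltr0n; near: n.
have n1 : 0 < n%:R :> R by rewrite ltr0n; near: n; exact: nbhs_infty_gt.
apply: (@le_trans _ _ B); first by rewrite /B le_max lexx.
move: h; rewrite ger0_norm ?divr_ge0// ltr_pdivrMr// mulrC ltr_pdivlMr// => h.
by rewrite ler_pdivlMr// ltW// mulrC.
Unshelve. all: by end_near. Qed.

Lemma expR_level (n : nat) (q : R) : (0 < n)%N -> (0 < k n)%N -> 0 < q ->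
  expR (ln (n%:R / (q * (k n)%:R))) = n%:R / (q * (k n)%:R) /\
  n%:R * expR (- ln (n%:R / (q * (k n)%:R))) = q * (k n)%:R.
Proof.
move=> n0 k0 q0; have nR : 0 < n%:R :> R by rewrite ltr0n.
have kR : 0 < (k n)%:R :> R by rewrite ltr0n.
have r0 : 0 < n%:R / (q * (k n)%:R) by rewrite divr_gt0// mulr_gt0.
split; first by rewrite lnK.
by rewrite expRN lnK//; field; rewrite !gt_eqF.
Qed.

Let t n : R := n%:R / (eta * (k n)%:R).

Lemma level_potter_half : \forall n \near \oo, potter_bounds alpha U (t n) (2^-1).
Proof.
have [t0 ht0] := potter_bounds_eventually alpha U (2^-1) alpha_gt0 U_RV ltac:(lra).
have hr := intermediate_ratio (eta * t0).
have k1 := intermediate_ge 1.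
near=> n; apply: ht0.
have h : eta * t0 <= n%:R / (k n)%:R by near: n.
have kn1 : 0 < (k n)%:R :> R by rewrite ltr0n; near: n.
have e0 : 0 < eta := lt_trans ltr01 eta_gt1.
rewrite /t invfM mulrCA mulrC ler_pdivlMr// mulrC //.
Unshelve. all: by end_near. Qed.

Lemma rate_small (c : R) : 0 < c -> \forall n \near \oo,
  potter_rate alpha U (t n) + (Num.sqrt (k n)%:R)^-1 <= c * theta (k n) /\
  0 <= potter_rate alpha U (t n).
Proof.
move=> c0; have hp := level_potter_half.
near=> n.
have hpn : potter_bounds alpha U (t n) 2^-1 by near: n.
split; last by have [] := potter_rate_lt alpha U (t n) 1 ltr01 (ex_intro _ _ hpn).
have h : `|(potter_rate alpha U (t n) + (k n)%:R `^ (- 2^-1)) / theta (k n)| <= c.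
  by near: n; exact: (cvgr0_norm_le _ theta_large _ c0).
rewrite -ler_pdivrMr//; apply: le_trans h; apply: le_trans (ler_norm _).
by rewrite powRN powR12_sqrt.
Unshelve. all: by end_near. Qed.

Lemma theta_sqrt_ge (A : R) : \forall n \near \oo, A <= theta (k n) * Num.sqrt (k n)%:R.
Proof.
pose B := Num.max A 1; have B0 : 0 < B by rewrite /B lt_max ltr01 orbT.
have Bi : 0 < B^-1 by rewrite invr_gt0.
have k1 := intermediate_ge 1.
have hs := rate_small B^-1 Bi.
near=> n.
have [h1 h2] : potter_rate alpha U (t n) + (Num.sqrt (k n)%:R)^-1 <= B^-1 * theta (k n) /\
  0 <= potter_rate alpha U (t n) by near: n.
have s0 : 0 < Num.sqrt (k n)%:R :> R by rewrite sqrtr_gt0 ltr0n; near: n.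
have : (Num.sqrt (k n)%:R)^-1 <= B^-1 * theta (k n) by lra.
rewrite -(ler_pM2r s0) mulVf ?gt_eqF// -mulrA ler_pdivlMl// mulr1.
by apply: le_trans; rewrite /B le_max lexx.
Unshelve. all: by end_near. Qed.

(** The regime of theta may change with n, so the level and the error are chosen separately for each
    n, while the guarantees are uniform. *)
Lemma good_level (kap K : R) : 0 < kap -> 0 < K -> 0 <= M -> kap * M <= 2^-1 ->
  \forall n \near \oo, exists L q e : R,
    [/\ 0 < L, 1 <= q & n%:R * expR (- L) = q * (k n)%:R] /\
    [/\ 0 < e <= kap * theta (k n), potter_bounds alpha U (expR L) e,
      K * theta (k n) ^+ 2 <= f (1 - q) & expR (- ((k n)%:R * f (1 - q))) <= 2^-1].
Proof.
move=> kap0 K0 M0 kapM.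
have e0 : 0 < eta := lt_trans ltr01 eta_gt1.
have e1 := eta_gt1; pose c := f (1 - eta).
have c0 : 0 < c.
  apply: (@lt_le_trans _ _ ((1 - eta) ^+ 2 / (2 * (2 - (1 - eta))))).
    by rewrite divr_gt0// ?exprn_even_gt0//=; lra.
  by apply: rate_fun_ge_sqr; lra.
(* Below d0, K theta^2 <= K theta <= c, so q = eta meets the requirement on f(1 - q). *)
pose d0 := Num.min 1 (c / K).
have d00 : 0 < d0 by rewrite /d0 lt_min ltr01 divr_gt0.
(* Large enough for the quadratic lower bound to give f(1 - q1) >= K M^2 + 1, which dominates K
   theta^2 for every theta <= M. *)
pose q1 := 3 + 4 * (K * M ^+ 2 + 1).
have KM0 : 0 <= K * M ^+ 2 by rewrite mulr_ge0 ?sqr_ge0// ltW.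
have fq1 : K * M ^+ 2 + 1 <= f (1 - q1).
  apply: (@le_trans _ _ ((1 - q1) ^+ 2 / (2 * (2 - (1 - q1))))); last first.
    by apply: rate_fun_ge_sqr; rewrite /q1; lra.
  rewrite ler_pdivlMr; last by rewrite /q1; lra.
  rewrite /q1; set z := K * M ^+ 2 + 1; have : 0 <= z by rewrite /z; lra.
  nra.
clear e1; have eta1 := eta_gt1; pose e1 := kap * d0 / 2.
have e10 : 0 < e1 by rewrite /e1 divr_gt0// mulr_gt0.
pose e2 := Num.min e1 2^-1.
have [t1 ht1] := potter_bounds_eventually alpha U e2 alpha_gt0 U_RV
  ltac:(rewrite /e2 lt_min e10 gt_min; apply/andP; split; [lra|apply/orP; right; lra]).
have hr := intermediate_ratio (Num.max (2 * eta) (q1 * Num.max 2 t1)).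
have hs := rate_small (kap / 2) ltac:(lra).
have hp := level_potter_half.
(* A lower bound for f(1 - q) valid in both regimes; k m >= 1 makes the failure probability at most
   exp (-1) <= 1 / 2. *)
pose m := Num.min c 1.
have m0 : 0 < m by rewrite /m lt_min c0 ltr01.
have [N hN] : exists N : nat, m^-1 < N%:R.
  by exists (Num.bound m^-1); rewrite archi_boundP// invr_ge0 ltW.
have hk := intermediate_ge N.+1.
near=> n.
have thM : theta (k n) <= M by near: n.
have th0 : 0 < theta (k n) by exact: theta_gt0.
have n0 : (0 < n)%N by near: n; exact: nbhs_infty_gt.
have kN : (N < k n)%N by near: n.
have k0 : (0 < k n)%N by exact: leq_ltn_trans kN.
have kR : 0 < (k n)%:R :> R by rewrite ltr0n.
have ratio : Num.max (2 * eta) (q1 * Num.max 2 t1) <= n%:R / (k n)%:R by near: n.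
have half q : m <= f (1 - q) -> expR (- ((k n)%:R * f (1 - q))) <= 2^-1.
  move=> mf; have : 1 <= (k n)%:R * f (1 - q).
    apply: (@le_trans _ _ ((k n)%:R * m)); last by rewrite ler_wpM2l.
    rewrite -ler_pdivrMr// mul1r (le_trans (ltW hN))// ler_nat ltnW//.
  rewrite expRN lef_pV2 ?posrE ?expR_gt0//.
  have := expR_ge1Dx ((k n)%:R * f (1 - q)); lra.
(* For small theta, e lies within k^(-1/2) of the Potter rate. For theta >= d0, the fixed error e2
   <= kap * d0 / 2 is already below kap * theta. *)
have [small|big] := ltP (theta (k n)) d0.
  have hpn : potter_bounds alpha U (t n) 2^-1 by near: n.
  have [h1 h2] : potter_rate alpha U (t n) + (Num.sqrt (k n)%:R)^-1 <= kap / 2 * theta (k n) /\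
    0 <= potter_rate alpha U (t n) by near: n.
  have s0 : 0 < (Num.sqrt (k n)%:R)^-1 :> R by rewrite invr_gt0 sqrtr_gt0.
  have [_ [e [he elt]]] := potter_rate_lt alpha U (t n) _ s0 (ex_intro _ _ hpn).
  have [hL1 hL2] := expR_level n eta n0 k0 e0.
  exists (ln (t n)), eta, e; split; split => //.
  - apply: ln_gt0; rewrite /t invfM mulrCA mulrC ltr_pdivlMr// mul1r.
    apply: lt_le_trans ratio; rewrite lt_max; apply/orP; left; lra.
  - exact: ltW.
  - have [ep _] := he; rewrite ep /=.
    by have := mulr_gt0 kap0 th0; lra.
  - by rewrite hL1.
  - rewrite -/c; apply: (@le_trans _ _ (K * theta (k n))).
      rewrite ler_pM2l// expr2 ler_piMl ?(ltW th0)//.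
      by apply: (le_trans (ltW small)); rewrite /d0 ge_min lexx.
    rewrite mulrC -ler_pdivlMr//; apply: (le_trans (ltW small)).
    by rewrite /d0 ge_min lexx orbT.
  - by apply: half; rewrite -/c /m ge_min lexx.
have q10 : 0 < q1 by rewrite /q1; lra.
have [hL1 hL2] := expR_level n q1 n0 k0 q10.
have tq : Num.max 2 t1 <= n%:R / (q1 * (k n)%:R).
  rewrite invfM mulrCA mulrC ler_pdivlMr// mulrC.
  by apply: le_trans ratio; rewrite le_max lexx orbT.
exists (ln (n%:R / (q1 * (k n)%:R))), q1, e2; split; split => //.
- apply: ln_gt0; apply: (@lt_le_trans _ _ 2); first by lra.
  by apply: le_trans tq; rewrite le_max lexx.
- by rewrite /q1; lra.
- rewrite /e2 lt_min e10 invr_gt0 ltr0n /= ge_min; apply/orP; left.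
  have h : kap * d0 <= kap * theta (k n) by rewrite ler_pM2l.
  by apply: le_trans h; rewrite /e1 ler_piMr ?mulr_ge0 ?(ltW kap0) ?(ltW d00)// invf_le1// ler1n.
- rewrite hL1; apply: ht1; apply: le_trans tq; by rewrite le_max lexx orbT.
- apply: (@le_trans _ _ (K * M ^+ 2)); last by lra.
  by rewrite ler_pM2l// ler_sqr ?nnegrE// ltW.
- by apply: half; rewrite /m ge_min; apply/orP; right; lra.
Unshelve. all: by end_near. Qed.

End levels.

(** * Measurability, and the law of the transformed exponential *)

Section hill_measurability.
Context {R : realType}.

Lemma measurable_invr : measurable_fun setT (fun x : R => x^-1).
Proof.
(* This form applies the power function to a nonnegative base only; at 0 both sides are 0. *)
rewrite (_ : (fun _ => _) = fun x : R => x * (x * x) `^ (-1)).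
  apply: measurable_funM => //.
  have mp : measurable_fun setT (fun x : R => x `^ (-1)) by exact: measurable_powR.
  have mx : measurable_fun setT (fun x : R => x * x) by exact: measurable_funM.
  exact: (measurableT_comp mp mx).
apply/funext => x; rewrite powR_inv1 -?expr2 ?sqr_ge0//.
by have [->|x0] := eqVneq x 0; [rewrite invr0 mul0r|field].
Qed.

Lemma measurable_hill_seq n k : measurable_fun setT (fun t : n.-tuple R => hill_seq k t).
Proof.
have mr i : measurable_fun setT (fun t : n.-tuple R => ranked i t).
  exact: (measurable_ranked n i _ (@measurable_id _ _ setT)).
apply: measurable_funM => //; apply: measurable_sum => i.
apply: measurableT_comp => //; apply: measurable_funM; first exact: mr.
exact: (measurableT_comp measurable_invr (mr k)).
Qed.

Lemma measurable_log_tail g (U : R -> R) : RV' g U -> measurable_fun setT (log_tail U).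
Proof.
by move=> hU; apply: nondecreasing_measurable => // x y; exact: (log_tail_nondecreasing g).
Qed.

End hill_measurability.

(** [log_tail U] departs from U o exp only on the half line x <= 0, which is null for Exp(1). *)
Lemma log_tail_law {R : realType} g (U : R -> R) (A : set R) : RV' g U -> measurable A ->
  exponential_prob 1 ([set s : R | 0 < s] `&` (U \o expR) @^-1` A) =
  std_exponential R (log_tail U @^-1` A).
Proof.
move=> hU mA.
have mV := measurable_log_tail g U hU.
have mVA : measurable (log_tail U @^-1` A) by rewrite -[X in measurable X]setTI; exact: mV.
have mpos : measurable [set s : R | 0 < s].
  by rewrite (_ : [set _ | _] = `]0, +oo[%classic)//; apply/seteqP; split => x /=; rewrite in_itv/= andbT.
have -> : [set s : R | 0 < s] `&` (U \o expR) @^-1` A =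
   [set s : R | 0 < s] `&` log_tail U @^-1` A.
  by apply/seteqP; split => s /= [s0 hA]; split => //; move: hA; rewrite /log_tail s0.
have expo_pos := std_exponential_gt0 (R := R).
have mposC : measurable (~` [set s : R | 0 < s]) by exact: measurableC.
have h0 : std_exponential R (~` [set s : R | 0 < s]) = 0%E.
  have h := probability_setC (std_exponential R) mpos.
  apply: (eq_trans h); apply: (eq_trans (congr1 (fun z => 1 - z)%E expo_pos)).
  by rewrite subee.
have h1 : std_exponential R (log_tail U @^-1` A `\` [set s : R | 0 < s]) = 0%E.
  apply/eqP; rewrite eq_le measure_ge0 andbT -h0.
  apply: le_measure; rewrite ?inE//; first exact: measurableD.
have h := measureDI (std_exponential R) mVA mpos.
apply: esym; apply: (eq_trans h); apply: (eq_trans (congr1 (fun z => z + _)%E h1)).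
by rewrite add0e setIC.
Qed.

(** * Tail asymptotics of the Hill statistic, for both signs *)

Section hill_tail.
Context {R : realType} {d : measure_display} {T : measurableType d}
  (P : probability T R) (alpha : R) (U : R -> R) (X : nat -> {RV P >-> R})
  (k : nat -> nat) (theta : nat -> R) (eta M : R).
Local Notation f := (@rate_fun R).
Local Notation expo := (std_exponential R).
Hypotheses (alpha_gt0 : 0 < alpha) (U_RV : RV' alpha^-1 U)
  (X_indep : mutually_independent X)
  (X_law : forall i : nat, has_tail_quantile U (X i))
  (k_intermediate : intermediate R k) (theta_gt0 : forall j : nat, 0 < theta j)
  (theta_le : \forall n \near \oo, theta (k n) <= M) (eta_gt1 : 1 < eta)
  (theta_large : much_larger (fun n : nat => theta (k n))
     (fun n : nat => potter_rate alpha U (n%:R / (eta * (k n)%:R)) + (k n)%:R `^ (- 2^-1))).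

Let V := log_tail U.

Let mV : measurable_fun setT V.
Proof. exact: (measurable_log_tail alpha^-1). Qed.

Let measurable_hill j n (S : set R) : measurable S ->
  measurable [set t : n.-tuple R | S (alpha * hill_seq j t)].
Proof.
move=> mS; rewrite -[X in measurable X]setTI.
have mah : measurable_fun setT (fun t : n.-tuple R => alpha * hill_seq j t).
  by apply: measurable_funM; [exact: measurable_cst|exact: measurable_hill_seq].
exact: (mah measurableT S mS).
Qed.

Let measurable_hill_event j n (S : set R) : measurable S ->
  measurable [set t : n.-tuple R | S (alpha * hill_seq j (map_tuple V t))].
Proof.
move=> mS; rewrite -[X in measurable X]setTI.
exact: (measurable_map_tuple V n mV measurableT _ (measurable_hill j n S mS)).
Qed.

Lemma hill_prob j n S : measurable S ->
  P [set w | S (alpha * hill (fun i => X i w) j n)] =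
  iid expo n [set t : n.-tuple R | S (alpha * hill_seq j (map_tuple V t))].
Proof.
move=> mS.
have V_law i A : measurable A -> distribution P (X i) A = expo (V @^-1` A).
  by move=> mA; rewrite (X_law i A mA); exact: (log_tail_law alpha^-1).
have h := sample_law P X V X_indep mV V_law n _ (measurable_hill j n S mS).
apply: (eq_trans _ h); congr (P _); apply/funext => w /=.
by rewrite hillE.
Qed.

(** The probabilistic part common to both tails. The separation hypothesis is deterministic
    arithmetic: a Potter error e and a window radius r, small against c |x|, do not carry the
    statistic h across the boundary of S n when D is at a dilated deviation. *)
Lemma hill_tail_asymp (x : nat -> R) (S : nat -> set R) (rho : R) :
  0 < rho <= 1 -> (forall n, `|x n| = theta (k n)) -> (\forall n \near \oo, x n <= 1 - rho) ->
  (forall n, measurable (S n)) ->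
  (forall n (h D e c r : R), x n <= 1 - rho -> `|x n| <= M -> 0 < c <= rho / 4 -> 0 < e <= 2^-1 ->
     e * (4 * (10 + 2 * M + 2 * alpha)) <= c * `|x n| ->
     (1 - e) * D - 2 * alpha * e <= h <= (1 + e) * D + alpha * e ->
     (S n h -> 0 <= - x n * (D - (1 - (1 - c) * x n))) /\
     (0 <= r -> r * (2 * (1 + 2 * M)) <= c * `|x n| ->
      `|D - (1 - (1 + 2 * c) * x n)| <= r * (1 - (1 + 2 * c) * x n) -> S n h)) ->
  asymp_equiv
    (fun n => neg_log_prob P [set w | S n (alpha * hill (fun i => X i w) (k n) n)])
    (fun n => (k n)%:R * f (x n)).
Proof.
move=> /andP[rho0 rho1] x_abs x_le mS S_sep.
have M0 : 0 <= M.
  have [N _ /(_ N (leqnn N)) h] := theta_le.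
  exact: le_trans (ltW (theta_gt0 (k N))) h.
pose p n := fine (P [set w | S n (alpha * hill (fun i => X i w) (k n) n)]).
(* One constant serves as the coefficient 16 of |x| sqrt k and as the prefactor 1 + 1 / rho of
   [tail_bounds]. *)
apply: (rate_asymp x p k M rho (16 + rho^-1)); rewrite ?rho0//.
- by have : 0 < rho^-1 by [rewrite invr_gt0]; lra.
- near=> n; apply/andP; split; last by near: n.
  have : theta (k n) <= M by near: n.
  by rewrite -x_abs ler_norml => /andP[].
- move=> A; near=> n; rewrite x_abs; near: n.
  exact: (theta_sqrt_ge alpha U k theta eta alpha_gt0 U_RV k_intermediate theta_gt0 eta_gt1
    theta_large).
move=> c /andP[c0 cr]; exists (4 * (1 + 2 * M))^-1.
  by rewrite invr_gt0; lra.
pose kap := c / (4 * (10 + 2 * M + 2 * alpha)).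
have den0 : 0 < 4 * (10 + 2 * M + 2 * alpha) by have := alpha_gt0; lra.
have kap0 : 0 < kap by rewrite divr_gt0.
have kapM : kap * M <= 2^-1.
  rewrite mulrAC ler_pdivrMr//.
  have : c * M <= 1 * M by rewrite ler_wpM2r//; lra.
  have := alpha_gt0; lra.
have rhoV0 : 0 < rho^-1 by rewrite invr_gt0.
have hl := good_level alpha U k theta eta M alpha_gt0 U_RV k_intermediate theta_gt0 theta_le
  eta_gt1 theta_large kap rho^-1 kap0 rhoV0 M0 kapM.
have hk := intermediate_ge k k_intermediate 256.
have hr := intermediate_ratio k k_intermediate 1.
(* This is the radius condition of the separation hypothesis for r = 8 / sqrt k, the relative radius
   of the concentration window. *)
have hs := theta_sqrt_ge alpha U k theta eta alpha_gt0 U_RV k_intermediate theta_gt0 eta_gt1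
  theta_large (16 * (1 + 2 * M) / c).
near=> n.
have kn : (256 <= k n)%N by near: n.
have kR : 0 < (k n)%:R :> R by rewrite ltr0n (leq_trans _ kn).
have [L [q [e [[L0 q1 nL] [/andP[e0 ek] pot fq half]]]]] : exists L q e : R,
    [/\ 0 < L, 1 <= q & n%:R * expR (- L) = q * (k n)%:R] /\
    [/\ 0 < e <= kap * theta (k n), potter_bounds alpha U (expR L) e,
      rho^-1 * theta (k n) ^+ 2 <= f (1 - q) & expR (- ((k n)%:R * f (1 - q))) <= 2^-1].
  by near: n.
have xle : x n <= 1 - rho by near: n.
have thM : theta (k n) <= M by near: n.
have kn_le : (k n <= n)%N.
  have : 1 <= n%:R / (k n)%:R :> R by near: n.
  by rewrite ler_pdivlMr// mul1r ler_nat.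
have ths : 16 * (1 + 2 * M) / c <= theta (k n) * Num.sqrt (k n)%:R by near: n.
have s0 : 0 < Num.sqrt (k n)%:R :> R by rewrite sqrtr_gt0.
have e12 : e <= 2^-1.
  by apply: (le_trans ek); apply: le_trans kapM; rewrite ler_pM2l.
pose Ev := [set t : n.-tuple R | S n (alpha * hill_seq (k n) (map_tuple V t))].
have pE : p n = fine (iid expo n Ev) by rewrite /p hill_prob.
have sep (t : n.-tuple R) r : L <= ranked (k n) t ->
  let D := excess (ranked (k n) t) t / (k n)%:R in
  (Ev t -> 0 <= - x n * (D - (1 - (1 - c) * x n))) /\
     (0 <= r -> r * (2 * (1 + 2 * M)) <= c * `|x n| ->
      `|D - (1 - (1 + 2 * c) * x n)| <= r * (1 - (1 + 2 * c) * x n) -> Ev t).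
  move=> Lt D; apply: (S_sep n _ D e c r); rewrite ?x_abs ?c0 ?e0//.
    by move: ek; rewrite /kap mulrAC ler_pdivlMr.
  apply: (hill_potter_bounds alpha U e L (k n) t) => //; last by rewrite size_tuple.
  by rewrite (leq_trans _ kn).
(* Since f(x) <= x^2 / (1 - x) <= theta^2 / rho, the constant K of [good_level] was taken to be 1 /
   rho. *)
have fx : f (x n) <= f (1 - q).
  apply: le_trans fq; apply: (le_trans (rate_fun_le_sqr (x n) _)); first lra.
  rewrite -x_abs real_normK ?num_real// mulrC ler_wpM2r ?sqr_ge0//.
  by rewrite lef_pV2 ?posrE//; lra.
have xM : - M <= x n <= 1 - rho.
  by rewrite xle andbT; move: thM; rewrite -x_abs ler_norml => /andP[].
have /andP[lo hi] : (4 * (1 + 2 * M))^-1 * expR (- ((k n)%:R * f ((1 + 2 * c) * x n))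
    - 16 * (`|x n| * Num.sqrt (k n)%:R)) <= fine (iid expo n Ev)
    <= (1 + rho^-1) * expR (- ((k n)%:R * f ((1 - c) * x n))).
  apply: (tail_bounds n (k n) L q (x n) c M rho Ev) => //; rewrite ?rho0 ?c0//.
    exact: measurable_hill_event.
  move=> t Lt Et; have [/(_ Et) h _] := sep t 0 Lt.
  rewrite (_ : - x n * _ = (k n)%:R *
    (- x n * (excess (ranked (k n) t) t / (k n)%:R - (1 - (1 - c) * x n)))).
    by rewrite mulr_ge0// ltW.
  by field; rewrite gt_eqF.
  move=> t Lt Dt; have [_ h] := sep t (8 / Num.sqrt (k n)%:R) Lt; apply: h.
  + by rewrite divr_ge0// ltW.
  + rewrite x_abs mulrAC ler_pdivrMr// -mulrA.
    by move: ths; rewrite ler_pdivrMr// => ths; lra.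
  + rewrite -(ler_pM2l kR) -[X in X * `|_|](ger0_norm (ltW kR)) -normrM.
    rewrite (_ : _ * (_ / _ - _) = excess (ranked (k n) t) t -
      (k n)%:R * (1 - (1 + 2 * c) * x n)); last by field; rewrite gt_eqF.
    apply: (le_trans Dt); rewrite mulrA le_eqVlt; apply/orP; left; apply/eqP.
    congr (_ * _).
    have ky : (k n)%:R = Num.sqrt (k n)%:R * Num.sqrt (k n)%:R :> R.
      by rewrite -expr2 sqr_sqrtr// ltW.
    by move: (Num.sqrt _) ky s0 => y -> y0; field; rewrite gt_eqF.
rewrite pE; split.
  apply: le_trans lo; rewrite ler_pM2l ?invr_gt0; last by lra.
  rewrite ler_expR lerD2l lerN2 ler_wpM2r//; last by lra.
apply: (le_trans hi); rewrite ler_pM2r ?expR_gt0//; lra.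
Unshelve. all: by end_near. Qed.

End hill_tail.

(** * The limsup condition and the two tails *)

Lemma limn_esup_lt_near {R : realType} (u : nat -> R) (a : R) :
  (limn_esup (fun n : nat => (u n)%:E) < a%:E)%E ->
  exists2 b : R, b < a & \forall n \near \oo, u n <= b.
Proof.
rewrite /limn_esup limf_esupE => /ereal_inf_lt[_ [A A_oo <-] supA].
have u_sup n : A n -> ((u n)%:E <= ereal_sup [set (u x)%:E | x in A])%E.
  by move=> An; apply: ereal_sup_ubound; exists n.
case: (ereal_sup _) supA u_sup => [b||] //= ba u_sup.
- exists b; first by rewrite -lte_fin.
  by apply: filterS A_oo => n /u_sup; rewrite lee_fin.
- by exists (a - 1); [lra|apply: filterS A_oo => n /u_sup; rewrite leeNy_eq].
Qed.

Theorem theorem1 (R : realType) (d : measure_display) (T : measurableType d)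
    (P : probability T R) (alpha : R) (U : R -> R) (X : nat -> {RV P >-> R})
    (k : nat -> nat) (theta : nat -> R) (eta : R)
    (alpha_gt0 : 0 < alpha)
    (U_RV : RV' alpha^-1 U)
    (X_indep : mutually_independent X)
    (X_law : forall i : nat, has_tail_quantile U (X i))
    (k_intermediate : intermediate R k)
    (theta_gt0 : forall j : nat, 0 < theta j)
    (theta_bigO : (fun n : nat => theta (k n)) =O_\oo (fun=> 1 : R))
    (eta_gt1 : 1 < eta)
    (theta_large : much_larger (fun n : nat => theta (k n))
       (fun n : nat => potter_rate alpha U (n%:R / (eta * (k n)%:R))
                       + (k n)%:R `^ (- 2^-1))) :
  [/\ (forall x : R, x < 1 -> 0 <= rate_fun x),
      asymp_equiv
        (fun n : nat => neg_log_prob P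
           [set w | 1 + theta (k n) < alpha * hill (fun i => X i w) (k n) n])
        (fun n : nat => (k n)%:R * rate_fun (- theta (k n)))
    & (limn_esup (fun n : nat => (theta (k n))%:E) < 1%:E)%E ->
      asymp_equiv
        (fun n : nat => neg_log_prob P
           [set w | alpha * hill (fun i => X i w) (k n) n < 1 - theta (k n)])
        (fun n : nat => (k n)%:R * rate_fun (theta (k n)))].
Proof.
have [M0 M0_gt0 thetaO] := (eqO_exP _ _ _).1 theta_bigO.
have theta_le : \forall n \near \oo, theta (k n) <= M0.
  by apply: filterS thetaO => n; rewrite normr1 mulr1 => h; rewrite (le_trans (ler_norm _)).
split.
- exact: rate_fun_ge0.
(* Upper tail: the deviation - theta is negative, so rho = 1 is available without an upper limit on
   theta below 1. *)
- apply: (hill_tail_asymp P alpha U X k theta eta M0 alpha_gt0 U_RV X_indep X_law k_intermediate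
    theta_gt0 theta_le eta_gt1 theta_large (fun n => - theta (k n))
    (fun n => [set h | 1 + theta (k n) < h]) 1).
  + by rewrite ltr01 lexx.
  + by move=> n; rewrite normrN gtr0_norm.
  + by near=> n; rewrite subrr oppr_le0 ltW.
  + move=> n; rewrite (_ : [set _ | _] = `]1 + theta (k n), +oo[%classic)//.
    by apply/seteqP; split => x /=; rewrite in_itv/= andbT.
  move=> n h D e c r _; rewrite normrN gtr0_norm//.
  have := theta_gt0 (k n); move: (theta (k n)) => th th0 thM /andP[c0 c1] /andP[e0 e1] ec /andP[h1 h2].
  have eM : e * th <= e * M0 by rewrite ler_pM2l.
  have ea : 0 <= e * alpha by rewrite mulr_ge0// ltW.
  have eM0 : 0 <= e * M0 by rewrite mulr_ge0// ltW.
  have cth : 0 <= c * th by rewrite mulr_ge0// ltW.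
  split=> [hS|r0 rc Ds].
    (* If D were below 1 + (1 - c) theta, the upper Potter bound would keep h at most 1 + theta,
       because e (1 + M0 + alpha) is at most c theta. *)
    rewrite opprK mulr_ge0 ?(ltW th0)// subr_ge0 leNgt; apply/negP => hD.
    have : (1 + e) * D <= (1 + e) * (1 - (1 - c) * - th) by rewrite ler_pM2l ?(ltW hD)//; lra.
    move: hS => /= hS.
    have : 0 <= e * (c * th) by rewrite mulr_ge0// ltW.
    lra.
  move: Ds; set s := 1 - _ => Ds.
  have sE : s = 1 + th + 2 * (c * th) by rewrite /s; ring.
  have s0 : 0 <= s by rewrite sE; lra.
  have cth4 : c * th <= 4^-1 * th by rewrite ler_pM2r//; lra.
  have sM : s <= 1 + 2 * M0 by rewrite sE; lra.
  move: Ds; rewrite ler_norml => /andP[Ds _].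
  (* The window is centred at s = 1 + theta + 2 c theta; its radius and the Potter error together
     cost less than c theta. *)
  have : (1 - e) * (s * (1 - r)) <= (1 - e) * D by rewrite ler_wpM2l//; lra.
  have : e * s <= e * (1 + 2 * M0) by rewrite ler_wpM2l// ltW.
  have : r * s <= r * (1 + 2 * M0) by rewrite ler_wpM2l.
  have : 0 <= e * (r * s) by rewrite !mulr_ge0// ltW.
  move=> /=; lra.
move=> /limn_esup_lt_near[b b1 theta_le_b].
(* The limsup condition keeps theta away from 1, where f has its singularity, leaving the margin
   rho. *)
pose rho := Num.min 1 (1 - b).
have rho0 : 0 < rho by rewrite /rho lt_min ltr01 subr_gt0.
have rhob : rho <= 1 - b by rewrite /rho ge_min lexx orbT.
apply: (hill_tail_asymp P alpha U X k theta eta M0 alpha_gt0 U_RV X_indep X_law k_intermediate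
  theta_gt0 theta_le eta_gt1 theta_large (fun n => theta (k n))
  (fun n => [set h | h < 1 - theta (k n)]) rho).
+ by rewrite rho0 /rho ge_min lexx.
+ by move=> n; rewrite gtr0_norm.
+ by apply: filterS theta_le_b => n; lra.
+ move=> n; rewrite (_ : [set _ | _] = `]-oo, 1 - theta (k n)[%classic)//.
move=> n h D e c r; rewrite gtr0_norm//.
have rho1 : rho <= 1 by rewrite /rho ge_min lexx.
have := theta_gt0 (k n).
move: (theta (k n)) => th th0 thr thM /andP[c0 c1] /andP[e0 e1] ec /andP[h1 h2].
have ea : 0 <= e * alpha by rewrite mulr_ge0// ltW.
have eM0 : 0 <= e * M0 by rewrite mulr_ge0// ltW.
have cth : 0 <= c * th by rewrite mulr_ge0// ltW.
have cth1 : c * th <= c by rewrite ler_piMr// ?(ltW c0)//; lra.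
have eth : 0 <= e * th by rewrite mulr_ge0// ltW.
split=> [hS|r0 rc Ds].
  rewrite mulNr oppr_ge0 mulr_ge0_le0 ?(ltW th0)// subr_le0 leNgt; apply/negP => hD.
  have : (1 - e) * (1 - (1 - c) * th) <= (1 - e) * D by rewrite ler_pM2l ?(ltW hD)//; lra.
  move: hS => /= hS.
  have : 0 <= e * (c * th) by rewrite mulr_ge0// ltW.
  have : e * (c * th) <= e * 1 by rewrite ler_wpM2l ?(ltW e0)//; lra.
  lra.
move: Ds; set s := 1 - _ => Ds.
have sE : s = 1 - th - 2 * (c * th) by rewrite /s; ring.
have s0 : 0 <= s by rewrite sE; lra.
have s1 : s <= 1 by rewrite sE; lra.
have rM : 0 <= r * M0 by rewrite mulr_ge0// ltW.
move: Ds; rewrite ler_norml => /andP[_ Ds].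
have : (1 + e) * D <= (1 + e) * (s * (1 + r)) by rewrite ler_wpM2l//; lra.
have : e * s <= e * 1 by rewrite ler_wpM2l// ltW.
have : r * s <= r * 1 by rewrite ler_wpM2l.
have : e * (r * s) <= 1 * (r * s) by rewrite ler_wpM2r ?mulr_ge0//; lra.
move=> /=; lra.
Unshelve. all: by end_near. Qed.
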